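(* There exists an absolute constant $\tau>2$ with the following property. Let $U\subseteq\mathbb{R}$ be an open interval and let $f:U\to\mathbb{R}$ be real-analytic. Suppose that $f$ is not the restriction to $U$ of a rational function in $\mathbb{R}(x)$ without poles on $U$. Then every nonempty open subinterval $V\subseteq U$ contains a Liouville number $\xi$ such that $$\mu(f(\xi))\le\tau.$$ In fact, $\xi\in V\cap\mathscr{L}$ may be chosen so that $$\left|f(\xi)-\frac ab\right|>b^{-\tau}$$ for every $a\in\mathbb{Z}$ and every sufficiently large integer $b$. One may take $\tau=100$.
   Context: A real number $\xi$ is a Liouville number if for every integer $N\ge 1$ there exist infinitely many pairs $(p,q)\in\mathbb{Z}\times\mathbb{Z}_{>0}$ with $q\ge 2$ such that $0<|\xi-p/q|<q^{-N}$. The set of Liouville numbers is denoted $\mathscr{L}$. The irrationality exponent of $y\in\mathbb{R}$ is $$\mu(y):=\sup\{\lambda>0:\ 0<|y-a/b|<b^{-\lambda}\text{ for infinitely many }(a,b)\in\mathbb{Z}\times\mathbb{Z}_{>0}\}.$$ *)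

(* Defs.v *)
From HB Require Import structures.
From mathcomp Require Import all_boot all_order all_algebra.
From mathcomp Require Import all_classical all_reals all_analysis.

Set Implicit Arguments.
Unset Strict Implicit.
Unset Printing Implicit Defensive.

Import Order.TTheory GRing.Theory Num.Theory.
Import numFieldNormedType.Exports.

Local Open Scope classical_set_scope.
Local Open Scope ring_scope.

Definition open_interval (R : realType) (U : set R) : Prop :=
  open U /\ is_interval U.

Definition liouville (R : realType) (xi : R) : Prop :=
  forall N : nat, (1 <= N)%N ->
    infinite_set [set pq : int * int | 2 <= pq.2 /\
      0 < `|xi - pq.1%:~R / pq.2%:~R| < (pq.2%:~R : R) ^- N].

(* The supremum is taken in the extended reals, so it is +oo when the set of
   exponents is unbounded. Pairs (a, b) need not be coprime. *)
Definition irrationality_exponent (R : realType) (y : R) : \bar R :=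
  ereal_sup [set lambda%:E | lambda in
    [set lambda : R | 0 < lambda /\
      infinite_set [set ab : int * int | 0 < ab.2 /\
        0 < `|y - ab.1%:~R / ab.2%:~R| < ab.2%:~R `^ (- lambda)]]].

(* A function on U is represented by a total f : R -> R. The predicates below
   do not depend on the values of f outside U (for the first one, because it is
   only used with U open). *)
Definition real_analytic_on (R : realType) (U : set R) (f : R -> R) : Prop :=
  forall x0 : R, U x0 -> exists c : nat -> R,
    \forall x \near x0, pseries c (x - x0) @ \oo --> f x.

Definition rational_on (R : realType) (U : set R) (f : R -> R) : Prop :=
  exists p q : {poly R}, [/\ q != 0,
    (forall x, U x -> q.[x] != 0) &
    (forall x, U x -> f x = p.[x] / q.[x])].

Definition admissible_exponent (R : realType) (tau : R) : Prop :=
  forall (U : set R) (f : R -> R),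
    open_interval U ->
    real_analytic_on U f ->
    ~ rational_on U f ->
    forall V : set R, open_interval V -> V !=set0 -> V `<=` U ->
    exists xi : R, [/\ V xi, liouville xi,
      (irrationality_exponent (f xi) <= tau%:E)%E &
      exists B : int, forall a b : int, B <= b ->
        `|f xi - a%:~R / b%:~R| > b%:~R `^ (- tau)].

(* Main.v *)
(* The number xi is a limit of rationals p/Q with Q = T^8, each step being much
   finer than the previous one, so that xi is Liouville.  Suppose 2m points
   x_k = p_k/Q lie in a window of length T^-7 around z and each f(x_k) is within
   b_k^-30 of some a_k/b_k with T^m <= b_k <= T^(m+1).  Form the determinant of
   the matrix with rows (x^i, x^i y)_(i < m) at (x_k, a_k/b_k).  Divided by the
   Vandermonde product of the x_k it is close to the Wronskian at z of
   1, x, .., x^(m-1), f, x f, .., x^(m-1) f, up to factorials, hence it is nonzero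
   and tiny, whereas its denominator divides Q^(m(m-1)) prod_k b_k: this is
   impossible for large T as soon as the Wronskian does not vanish at z.  So
   a window of T consecutive fractions p/Q contains one for which f(p/Q) is
   badly approximable by all a/b with T <= b < T^L.  Since f is not rational, the
   zeros of the Wronskians are isolated, and a measure estimate provides z
   outside them such that f(z) is badly approximable by all a/b with b up to T. *)
Require Import Defs.
From mathcomp Require Import all_boot all_order all_algebra.
From mathcomp Require Import all_classical all_reals all_analysis.
From mathcomp Require Import ring lra zify.
Set Implicit Arguments.
Unset Strict Implicit.
Unset Printing Implicit Defensive.
Import Order.TTheory GRing.Theory Num.Theory.
Import numFieldNormedType.Exports.
Local Open Scope classical_set_scope.
Local Open Scope ring_scope.

(** * Germs of power series *)

Section PowerSeriesGerms.
Variable R : realType.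
Implicit Types (c d : nat -> R) (h g : R -> R).

(** Each of the [n.+1] terms [s ^+ i] with [i <= n] is at least [s ^+ n], and the partial geometric
    sum is at most [(1 - s)^-1]. *)
Lemma mulrn_exprn_bounded (s : R) : 0 <= s -> s < 1 ->
  forall n, n.+1%:R * s ^+ n <= (1 - s)^-1.
Proof.
move=> s0 s1 n; have s10 : 0 < 1 - s by rewrite subr_gt0.
rewrite -[leRHS]mul1r ler_pdivlMr//.
apply: (@le_trans _ _ ((\sum_(i < n.+1) s ^+ i) * (1 - s))).
  rewrite ler_pM2r// -[X in X%:R]card_ord mulr_natl -sumr_const.
  by apply: ler_sum => i _; apply: ler_wiXn2l => //; [exact: ltW|rewrite -ltnS].
rewrite mulrC -opprB mulNr -subrX1 opprB.
by rewrite lerBlDr lerDl exprn_ge0.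
Qed.

(** Abel's lemma: comparison with the geometric series of ratio [|z| / t]. *)
Lemma pseries_bounded_cvg c (t z M : R) : (forall n, `|c n * t ^+ n| <= M) ->
  `|z| < t -> cvgn (pseries c z).
Proof.
move=> cM zt; have t0 : 0 < t by exact: le_lt_trans zt.
have M0 : 0 <= M by exact: le_trans (cM 0).
apply: normed_cvg.
have g0 n : 0 <= geometric M (`|z| / t) n.
  by rewrite /= mulr_ge0// exprn_ge0// divr_ge0// ltW.
apply: series_le_cvg g0 _ _ => [n|n|].
- exact: normr_ge0.
- rewrite /= expr_div_n normrM normrX.
  rewrite (_ : _ * _ = `|c n * t ^+ n| * (`|z| ^+ n / t ^+ n)).
    by rewrite ler_wpM2r// divr_ge0 ?exprn_ge0// ltW.
  rewrite normrM normrX (gtr0_norm t0).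
  by field; rewrite expf_eq0 gt_eqF ?andbF.
- apply: is_cvg_geometric_series.
  by rewrite normrM normr_id normfV (gtr0_norm t0) ltr_pdivrMr// mul1r.
Qed.

(** For [t] strictly between [|z|] and [|K|], the bounds on [c n * K ^+ n] and on
    [n.+1 * (t / |K|) ^+ n] bound the terms of the derived series at [t], and Abel's lemma
    applies. *)
Lemma cvg_pseries_diffs_inside c (K z : R) : cvgn (pseries c K) ->
  `|z| < `|K| -> cvgn (pseries (pseries_diffs c) z).
Proof.
move=> cK zK; have K0 : 0 < `|K| by exact: le_lt_trans zK.
have [t zt tK] : exists2 t, `|z| < t & t < `|K|.
  by have := midf_lt zK => -[? ?]; exists ((`|z| + `|K|) / 2).
have t0 : 0 < t by exact: le_lt_trans zt.
have [M [Mreal Mf]] := cvg_series_bounded cK.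
have {Mf} Mf n : `|c n * K ^+ n| <= `|M + 1|.
  by apply: Mf => //; rewrite (lt_le_trans _ (ler_norm _))// ltrDl.
have s0 : 0 <= t / `|K| by rewrite divr_ge0 ?ltW.
have s1 : t / `|K| < 1 by rewrite ltr_pdivrMr// mul1r.
apply: (@pseries_bounded_cvg _ t z (`|M + 1| / `|K| * (1 - t / `|K|)^-1)) => // n.
rewrite /pseries_diffs; have := mulrn_exprn_bounded s0 s1 n.
move=> /(ler_pM _ _ (Mf n.+1)).
have -> : `|c n.+1 * K ^+ n.+1| * (n.+1%:R * (t / `|K|) ^+ n)
   = `|n.+1%:R * c n.+1 * t ^+ n| * `|K|.
  rewrite !normrM !normrX (gtr0_norm t0) expr_div_n normr_nat exprS.
  by field; rewrite expf_eq0 gt_eqF ?andbF.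
rewrite -ler_pdivlMr// => le; apply: le_trans (le _ _) _ => //.
  by rewrite mulr_ge0// exprn_ge0.
by rewrite mulrAC.
Qed.

Definition hasps (x0 : R) c h :=
  \forall x \near x0, pseries c (x - x0) @ \oo --> h x.

Lemma hasps_radius x0 c h : hasps x0 c h -> exists2 r : R, 0 < r &
  forall x, `|x - x0| < r -> pseries c (x - x0) @ \oo --> h x.
Proof.
move=> /nbhs_ballP[r /= r0 hr]; exists r => // x xr; apply: hr.
by rewrite /ball/= distrC.
Qed.

Lemma near_radius (x0 r : R) (P : R -> Prop) : 0 < r ->
  (forall x, `|x - x0| < r -> P x) -> \forall x \near x0, P x.
Proof.
move=> r0 hr; apply/nbhs_ballP; exists r => //= x; rewrite /ball/= distrC.
exact: hr.
Qed.

Lemma hasps_derive x0 c h : hasps x0 c h ->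
  (\forall x \near x0, is_derive (x : R) 1 h ((derive1 h) x)) /\
  hasps x0 (pseries_diffs c) (derive1 h).
Proof.
move=> /hasps_radius[r r0 hr].
(* The radius is halved three times: termwise differentiation asks for convergence of the series and
   of its first two derived series, each obtained strictly inside the previous radius. *)
have r40 : 0 < r / 2 / 2 by rewrite !divr_gt0.
have r21 : r / 2 < r by rewrite ltr_pdivrMr// ltr_pMr// ltr1n.
have r42 : r / 2 / 2 < r / 2 by rewrite ltr_pdivrMr ?divr_gt0// ltr_pMr ?divr_gt0// ltr1n.
have r84 : r / 2 / 2 / 2 < r / 2 / 2 by rewrite ltr_pdivrMr ?divr_gt0// ltr_pMr ?divr_gt0// ltr1n.
have [r20 r80] : 0 < r / 2 /\ 0 < r / 2 / 2 / 2 by rewrite !divr_gt0.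
have cr : cvgn (pseries c (r / 2)).
  have := hr (x0 + r / 2); rewrite addrAC subrr add0r gtr0_norm// => /(_ r21) H.
  by apply/cvg_ex; eexists; exact: H.
have dr : cvgn (pseries (pseries_diffs c) (r / 2 / 2)).
  by apply: cvg_pseries_diffs_inside cr _; rewrite !gtr0_norm.
have ddr : cvgn (pseries (pseries_diffs (pseries_diffs c)) (r / 2 / 2 / 2)).
  by apply: cvg_pseries_diffs_inside dr _; rewrite !gtr0_norm.
have H x : `|x - x0| < r / 2 / 2 / 2 ->
    is_derive x 1 h (limn (pseries (pseries_diffs c) (x - x0))).
  move=> xr.
  have D0 : is_derive (x - x0) 1 (fun x => limn (pseries c x))
     (limn (pseries (pseries_diffs c) (x - x0))).
    apply: (@pseries_snd_diffs _ c (r / 2 / 2 / 2)) => //.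
    - by apply: is_cvg_pseries_inside cr _; rewrite !gtr0_norm// (lt_trans r84).
    - by apply: is_cvg_pseries_inside dr _; rewrite !gtr0_norm.
    - by rewrite [ltRHS]gtr0_norm.
  have D1 : is_derive x 1 (fun y : R => y - x0) 1.
    by apply: is_derive_eq; rewrite subr0.
  have := @is_derive1_comp _ (fun x => limn (pseries c x)) (fun y : R => y - x0) x _ _ D0 D1; rewrite mulr1.
  apply: near_eq_is_derive; near=> y.
  apply/cvg_lim => //; apply: hr.
  near: y; apply: open_nbhs_nbhs; split => //=.
    rewrite (_ : (fun y => _) = ball x0 r); first exact: ball_open.
    by apply/funext => y; rewrite /ball/= distrC.
  apply: lt_trans xr _; apply: lt_trans r84 _; exact: lt_trans r42 _.
have dE x : `|x - x0| < r / 2 / 2 / 2 ->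
    derive1 h x = limn (pseries (pseries_diffs c) (x - x0)).
  by move=> xr; have xD := H _ xr; rewrite derive1E derive_val.
split; first by apply: (near_radius r80) => x xr; rewrite (dE _ xr); exact: H.
apply: (near_radius r80) => x xr; rewrite (dE _ xr).
apply: is_cvg_pseries_inside dr _.
by rewrite [ltRHS]gtr0_norm// (lt_trans xr).
Unshelve. all: by end_near. Qed.


Lemma hasps_continuous x0 c h : hasps x0 c h -> {for x0, continuous h}.
Proof.
move=> /hasps_derive[/nbhs_singleton hd _].
by apply/differentiable_continuous/derivable1_diffP.
Qed.

Lemma eq_hasps x0 c d h : c =1 d -> hasps x0 c h -> hasps x0 d h.
Proof. by move=> /funext ->. Qed.

Lemma hasps_cst x0 (a : R) : hasps x0 (fun n => if n is 0%N then a else 0) (cst a).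
Proof.
apply: (@filterE _ (nbhs x0)) => x; rewrite -cvg_shiftS /=; apply: cvg_near_cst; near=> n.
rewrite /pseries /series /= big_nat_recl// expr0 mulr1 big1 ?addr0// => i _.
by rewrite mul0r.
Unshelve. all: by end_near. Qed.

Lemma haspsD x0 c d h g : hasps x0 c h -> hasps x0 d g ->
  hasps x0 (fun n => c n + d n) (fun x => h x + g x).
Proof.
move=> hc gd; near=> x.
have -> : pseries (fun n => c n + d n) (x - x0) =
   (fun n => pseries c (x - x0) n + pseries d (x - x0) n).
  apply/funext => n; rewrite /pseries /series /= -big_split/=.
  by apply: eq_bigr => i _; rewrite mulrDl.
apply: cvgD.
  by near: x; exact: hc.
by near: x; exact: gd.
Unshelve. all: by end_near. Qed.

Lemma haspsZ x0 (a : R) c h : hasps x0 c h ->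
  hasps x0 (fun n => a * c n) (fun x => a * h x).
Proof.
apply: filterS => x hc.
have -> : pseries (fun n => a * c n) (x - x0) = (fun n => a * pseries c (x - x0) n).
  apply/funext => n; rewrite /pseries /series /= mulr_sumr.
  by apply: eq_bigr => i _; rewrite mulrA.
by apply: cvgM => //; exact: cvg_cst.
Qed.

Lemma hasps_sum x0 (I : Type) (r : seq I) (P : pred I) (c : I -> nat -> R)
    (h : I -> R -> R) : (forall i, P i -> hasps x0 (c i) (h i)) ->
  hasps x0 (fun n => \sum_(i <- r | P i) c i n) (fun x => \sum_(i <- r | P i) h i x).
Proof.
move=> H; elim: r => [|i r IH].
  apply: (@filterE _ (nbhs x0)) => x.
  have -> : pseries (fun n => \sum_(i <- [::] | P i) c i n) (x - x0) = cst 0.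
    apply/funext => n; rewrite /pseries /series /= big1// => j _.
    by rewrite big_nil mul0r.
  by rewrite big_nil; exact: cvg_cst.
case: (boolP (P i)) => Pi; last first.
  rewrite (_ : (fun n => _) = fun n => \sum_(i <- r | P i) c i n); last first.
    by apply/funext => n; rewrite big_cons (negbTE Pi).
  rewrite (_ : (fun x => _) = fun x => \sum_(i <- r | P i) h i x)//.
  by apply/funext => x; rewrite big_cons (negbTE Pi).
rewrite (_ : (fun n => _) = fun n => c i n + \sum_(i <- r | P i) c i n); last first.
  by apply/funext => n; rewrite big_cons Pi.
rewrite (_ : (fun x => _) = fun x => h i x + \sum_(i <- r | P i) h i x).
  by apply: haspsD => //; exact: H.
by apply/funext => x; rewrite big_cons Pi.
Qed.

Lemma hasps_mulXB x0 c h : hasps x0 c h ->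
  hasps x0 (fun n => if n is k.+1 then c k else 0) (fun x => (x - x0) * h x).
Proof.
apply: filterS => x hc; rewrite -cvg_shiftS /=.
rewrite (_ : (fun n => _) = (fun n => (x - x0) * pseries c (x - x0) n)).
  by apply: cvgM => //; exact: cvg_cst.
apply/funext => n; rewrite /pseries /series /= big_nat_recl// mul0r add0r.
by rewrite mulr_sumr; apply: eq_bigr => i _; rewrite exprS mulrCA.
Qed.

Lemma hasps_mulX x0 c h : hasps x0 c h ->
  exists d, hasps x0 d (fun x => x * h x).
Proof.
move=> hc; have := haspsD (hasps_mulXB hc) (haspsZ x0 hc).
set d := (X in hasps _ X _) => H; exists d.
rewrite (_ : (fun x => _) = (fun x => (x - x0) * h x + x0 * h x))//.
by apply/funext => x; rewrite mulrBl subrK.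
Qed.

(** Dividing by [(x - x0) ^+ k] shifts the coefficients by [k], so the quotient, given the value
    [c k] at [x0], is again a power series and is continuous there. *)
Lemma hasps_lead x0 c h k : hasps x0 c h -> (forall n, (n < k)%N -> c n = 0) ->
  (h x / (x - x0) ^+ k) @[x --> x0^'] --> c k.
Proof.
move=> hc c0.
pose g x := if x == x0 then c k else h x / (x - x0) ^+ k.
have gc : hasps x0 (fun n => c (n + k)%N) g.
  apply: filterS hc => x; rewrite -(cvg_shiftn k) /g.
  case: eqVneq => [->{x} _|xx0 hx].
    rewrite subrr -cvg_shiftS /=; apply: cvg_near_cst; near=> n.
    rewrite /pseries /series /= big_nat_recl// expr0 mulr1 add0n big1 ?addr0// => i _.
    by rewrite expr0n mulr0.
  have xx00 : x - x0 != 0 by rewrite subr_eq0.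
  rewrite (_ : pseries _ _ = fun n => pseries c (x - x0) (n + k)%N / (x - x0) ^+ k).
    by apply: cvgM => //; exact: cvg_cst.
  apply/funext => n; rewrite /pseries /series /=.
  rewrite [X in _ = X / _](@big_cat_nat _ _ _ k)//= ?leq_addl//.
  have -> : \sum_(0 <= i < k) c i * (x - x0) ^+ i = 0.
    by rewrite big_nat_cond big1// => i /andP[/andP[_ ik] _]; rewrite c0// mul0r.
  rewrite add0r.
  rewrite [X in _ = X / _](_ : _ = \sum_(0 + k <= i < n + k) c i * (x - x0) ^+ i)//.
  rewrite big_addn addnK mulr_suml.
  by apply: eq_bigr => i _; rewrite exprD mulrA mulfK// expf_neq0.
have gk : g x0 = c k by rewrite /g eqxx.
have gx0 : g x @[x --> x0^'] --> c k.
  by rewrite -gk; apply: cvg_within_filter; exact: hasps_continuous gc.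
apply: cvg_trans gx0; apply: near_eq_cvg; near=> x; rewrite /g ifF//.
by apply/negbTE; near: x; exact: nbhs_dnbhs_neq.
Unshelve. all: by end_near. Qed.

Lemma hasps_eq0 x0 c h : hasps x0 c h -> (forall n, c n = 0) ->
  \forall x \near x0, h x = 0.
Proof.
move=> + c0; apply: filterS => x /(cvg_lim _) <-//; apply/cvg_lim => //.
apply: cvg_near_cst; near=> n.
by rewrite /pseries /series /= big1// => i _; rewrite c0 mul0r.
Unshelve. all: by end_near. Qed.

(** For the least [k] with [c k != 0], the quotient of [h] by [(x - x0) ^+ k] tends to [c k], so [h]
    cannot vanish arbitrarily close to [x0]. *)
Lemma hasps_neq0 x0 c h : hasps x0 c h -> (exists n, c n != 0) ->
  \forall x \near x0^', h x != 0.
Proof.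
move=> hc c0; have [k ck kmin] := ex_minnP c0.
have ck0 n : (n < k)%N -> c n = 0.
  by move=> nk; apply/eqP; apply: contraTT nk => /kmin; rewrite -leqNgt.
have /cvgrPdist_lt /(_ `|c k|) := hasps_lead hc ck0.
rewrite normr_gt0 => H; near=> x; apply/negP => /eqP hx.
have : `|c k - h x / (x - x0) ^+ k| < `|c k|.
  by near: x; apply: H.
by rewrite hx mul0r subr0 ltxx.
Unshelve. all: by end_near. Qed.

Lemma iter_pseries_diffs l c n :
  iter l (@pseries_diffs R) c n = ((n + l) ^_ l)%:R * c (n + l)%N.
Proof.
elim: l n => [|l IH] n; first by rewrite addn0 ffactn0 mul1r.
rewrite iterS /pseries_diffs IH mulrA -natrM addSnnS; congr (_%:R * _).
by rewrite ffactnSr mulnC -addSnnS addnK.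
Qed.

Lemma hasps_derive1n x0 c h l : hasps x0 c h ->
  hasps x0 (iter l (@pseries_diffs R) c) (derive1n l h).
Proof.
move=> hc; elim: l => [|l IH]; first by rewrite derive1n0.
by rewrite derive1nS iterS; apply: (hasps_derive IH).2.
Qed.

(* The Euler-type operator [(x - x0)^l d^l/dx^l] acts diagonally on Taylor coefficients. *)
Lemma hasps_euler x0 c h l : hasps x0 c h ->
  hasps x0 (fun n => (n ^_ l)%:R * c n) (fun x => (x - x0) ^+ l * (derive1n l h) x).
Proof.
move=> hc; have {}hc := hasps_derive1n l hc.
have H k : hasps x0 (fun n => if (n < k)%N then 0 else
    iter l (@pseries_diffs R) c (n - k)%N) (fun x => (x - x0) ^+ k * (derive1n l h) x).
  elim: k => [|k IH].
    rewrite (_ : (fun x => _) = (derive1n l h)); last by apply/funext => x; rewrite expr0 mul1r.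
    by apply: eq_hasps hc => n; rewrite subn0.
  have := hasps_mulXB IH.
  rewrite (_ : (fun x => (x - x0) * _) = (fun x => (x - x0) ^+ k.+1 * (derive1n l h) x)).
    by apply: eq_hasps => -[|n]//; rewrite ltnS subSS.
  by apply/funext => x; rewrite exprS mulrA.
apply: eq_hasps (H l) => n; case: ltnP => nl; first by rewrite ffact_small// mul0r.
by rewrite iter_pseries_diffs subnK.
Qed.

End PowerSeriesGerms.

(** * Isolated zeros of Wronskians *)

Section Wronskian.
Variable R : realType.

Lemma cvg_det N (A : 'M[R]_N) (T : Type) (F : set_system T) (B : T -> 'M[R]_N) :
  Filter F -> (forall i j, B t i j @[t --> F] --> A i j) ->
  \det (B t) @[t --> F] --> \det A.
Proof.
move=> FF BA; apply: cvg_big; first exact: add_continuous.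
move=> s _; apply: cvgM; first exact: cvg_cst.
apply: cvg_big; first exact: mul_continuous.
by move=> i _; exact: BA.
Qed.

Lemma det_near N (A : 'M[R]_N) (e : R) : 0 < e -> exists2 eta : R, 0 < eta &
  forall B : 'M[R]_N, (forall i j, `|B i j - A i j| < eta) ->
    `|\det B - \det A| < e.
Proof.
move=> e0.
have cdet : (\det B) @[B --> A] --> \det A.
  by apply: (@cvg_det _ _ _ (nbhs A) id) => i j; exact: coord_continuous.
move/cvgrPdist_lt : cdet => /(_ _ e0) /nbhs_ballP[eta /= eta0 H].
exists eta => // B BA; rewrite distrC; apply: H; split => // i j.
by rewrite /ball/= distrC.
Qed.

(** The combinations are built one at a time. By rank, some nonzero combination has zero
    coefficients at the [k < N] orders found so far; by freeness it has an order, which is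
    necessarily new. *)
Lemma distinct_orders N (c : 'I_N -> nat -> R) :
  (forall lam : 'rV[R]_N, (forall n, \sum_j lam 0 j * c j n = 0) -> lam = 0) ->
  exists (A : 'M[R]_N) (o : 'I_N -> nat), injective o /\
    forall a, (forall n, (n < o a)%N -> \sum_j A a j * c j n = 0) /\
      \sum_j A a j * c j (o a) != 0.
Proof.
move=> free_c.
suff /(_ N (leqnn N))[A [w [wI wP]]] : forall k, (k <= N)%N ->
    exists (A : nat -> 'rV[R]_N) (w : nat -> nat),
    (forall a b, (a < k)%N -> (b < k)%N -> w a = w b -> a = b) /\
    forall a, (a < k)%N ->
     (forall n, (n < w a)%N -> \sum_j A a 0 j * c j n = 0) /\
      \sum_j A a 0 j * c j (w a) != 0.
  exists (\matrix_(i, j) A i 0 j), (fun i => w i); split.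
    by move=> a b /wI ab; apply/val_inj/ab.
  move=> a; have [oa1 oa2] := wP a (ltn_ord a); split.
    by move=> n /oa1 {2}<-; apply: eq_bigr => j _; rewrite mxE.
  by under eq_bigr do rewrite mxE.
elim => [|k IH] kN.
  by exists (fun=> 0), (fun=> 0%N).
have [A [w [wI wP]]] := IH (ltnW kN).
pose B : 'M[R]_(N, k) := \matrix_(j, i) c j (w i).
have : kermx B != 0.
  rewrite -mxrank_eq0 mxrank_ker subn_eq0 -ltnNge.
  by rewrite (leq_ltn_trans (rank_leq_col B)).
move=> /rowV0Pn[lam /sub_kermxP lamB lam0].
have exn : exists n, \sum_j lam 0 j * c j n != 0.
  apply: contrapT => /forallNP H; move/negP: lam0; apply; apply/eqP/free_c => n.
  by apply/eqP/negPn/negP; exact: H.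
have [on on0 onmin] := ex_minnP exn.
have on_new a : (a < k)%N -> w a != on.
  move=> ak; apply/eqP => oa; move/rowP: lamB => /(_ (Ordinal ak)).
  rewrite !mxE /=; under eq_bigr do rewrite mxE /= oa.
  by move/eqP; rewrite (negbTE on0).
exists (fun a => if a == k then lam else A a), (fun a => if a == k then on else w a).
split.
  move=> a b; rewrite !ltnS => ak bk.
  case: eqVneq => [ak'|ak']; case: eqVneq => [bk'|bk'].
  - by rewrite ak' bk'.
  - move=> onb; have /on_new : (b < k)%N by rewrite ltn_neqAle bk'.
    by rewrite onb eqxx.
  - move=> onb; have /on_new : (a < k)%N by rewrite ltn_neqAle ak'.
    by rewrite onb eqxx.
  - by apply: wI; rewrite ltn_neqAle ?ak' ?bk'.
move=> a; rewrite ltnS => ak; case: eqVneq => [_|ak'].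
  split => // n nn; apply/eqP; apply: contraTT nn => /onmin.
  by rewrite -leqNgt.
by apply: wP; rewrite ltn_neqAle ak'.
Qed.

Lemma horner_ffact_poly l n :
  (\prod_(t < l) ('X - (t%:R)%:P)).[n%:R] = (n ^_ l)%:R :> R.
Proof.
elim: l => [|l IH]; first by rewrite big_ord0 hornerC ffactn0.
rewrite big_ord_recr /= hornerM IH !hornerE ffactnSr natrM.
have [ln|nl] := leqP l n; first by rewrite natrB.
by rewrite ffact_small// !mul0r.
Qed.

(** A kernel vector is a polynomial of degree less than [N], written in the basis of falling
    factorials, that vanishes at the [N] distinct points [o a]. *)
Lemma det_ffact_neq0 N (o : 'I_N -> nat) : injective o ->
  \det (\matrix_(a < N, l < N) ((o a) ^_ l)%:R : 'M[R]_N) != 0.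
Proof.
move=> oI; rewrite -det_tr; apply/negP => /det0P[v v0 /rowP vM].
pose P : {poly R} := \sum_(l < N) v 0 l *: \prod_(t < l) ('X - (t%:R)%:P).
have PE n : P.[n%:R] = \sum_(l < N) v 0 l * (n ^_ l)%:R.
  rewrite /P horner_sum; apply: eq_bigr => l _.
  by rewrite hornerZ horner_ffact_poly.
have P0 : P = 0.
  apply/eqP; apply: contraT => P0.
  have sP : (size P <= N)%N.
    apply: leq_trans (size_sum _ _ _) _; apply/bigmax_leqP => l _.
    apply: leq_trans (size_scale_leq _ _) _.
    by rewrite size_prod_XsubC /index_enum -enumT size_enum_ord.
  have := @max_poly_roots _ P [seq (o a)%:R | a <- enum 'I_N] P0.
  rewrite size_map size_enum_ord ltnNge sP; apply.
    apply/allP => _ /mapP[a _ ->]; rewrite /root PE.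
    have := vM a; rewrite !mxE => vMa; apply/eqP; rewrite -[RHS]vMa.
    by apply: eq_bigr => l _; rewrite !mxE.
  rewrite map_inj_uniq ?enum_uniq// => a b /eqP; rewrite eqr_nat => /eqP.
  exact: oI.
(* Evaluating [P = 0] at [l] leaves only the term of index [l]: lower coefficients vanish by
   induction, and higher falling factorials vanish at [l]. *)
move/negP: v0; apply; apply/eqP/rowP => -[l lN]; rewrite mxE.
elim/ltn_ind: l lN => l IH lN; have := PE l; rewrite P0 horner0.
rewrite (bigD1 (Ordinal lN))//= ffactnn big1 ?addr0; last first.
  move=> [i iN]; rewrite -val_eqE /= neq_ltn => /orP[il|li].
    by rewrite IH// mul0r.
  by rewrite ffact_small// mulr0.
move/esym/eqP; rewrite mulf_eq0 pnatr_eq0 (gtn_eqF (fact_gt0 l)) orbF => /eqP ->//.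
Qed.

Definition wronskian_mx N (v : 'I_N -> R -> R) (x : R) : 'M[R]_N :=
  \matrix_(l < N, j < N) derive1n l (v j) x.

(* Rows of [A] combine the [v j] into functions with pairwise distinct orders
   [o a] at [x0]; after rescaling, their Wronskian tends to a nonzero multiple
   of the determinant of falling factorials [(o a) ^_ l]. *)
Lemma wronskian_isolated_zeros N (v : 'I_N -> R -> R) x0 (c : 'I_N -> nat -> R) :
  (forall j, hasps x0 (c j) (v j)) ->
  (forall lam : 'rV[R]_N, (forall n, \sum_j lam 0 j * c j n = 0) -> lam = 0) ->
  \forall x \near x0^', \det (wronskian_mx v x) != 0.
Proof.
move=> vc /distinct_orders[A [w [wI wP]]].
pose gam a := \sum_j A a j * c j (w a).
pose Lam := diag_mx (\row_a gam a) *m (\matrix_(a < N, l < N) ((w a) ^_ l)%:R : 'M[R]_N).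
have Lam0 : \det Lam != 0.
  rewrite det_mulmx det_diag mulf_neq0 ?det_ffact_neq0//.
  by apply/prodf_neq0 => a _; rewrite mxE; have [] := wP a.
have LamE a l : Lam a l = ((w a) ^_ l)%:R * gam a.
  by rewrite /Lam mul_diag_mx !mxE mulrC.
(* The determinant of [E x] has that of the Wronskian matrix as a factor, while its entries are
   Euler operators applied to the combinations, divided by their leading powers. *)
pose E x : 'M[R]_N := diag_mx (\row_a ((x - x0) ^+ w a)^-1) *m
  (A *m (wronskian_mx v x)^T) *m diag_mx (\row_l (x - x0) ^+ l).
have EE x a l : E x a l =
    (\sum_j A a j * ((x - x0) ^+ l * derive1n l (v j) x)) / (x - x0) ^+ w a.
  rewrite /E mul_mx_diag mul_diag_mx !mxE [RHS]mulrC -mulrA; congr (_ * _).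
  by rewrite mulr_suml; apply: eq_bigr => j _; rewrite !mxE mulrAC mulrA.
have Ecvg a l : E x a l @[x --> x0^'] --> Lam a l.
  under eq_cvg do rewrite EE.
  have H : hasps x0 (fun n => \sum_j A a j * ((n ^_ l)%:R * c j n))
      (fun x => \sum_j A a j * ((x - x0) ^+ l * derive1n l (v j) x)).
    apply: (@hasps_sum _ _ _ _ _ (fun j n => A a j * ((n ^_ l)%:R * c j n))) => j _.
    by apply: haspsZ; apply: hasps_euler.
  rewrite LamE (_ : _ * gam a = \sum_j A a j * (((w a) ^_ l)%:R * c j (w a))).
    apply: (hasps_lead H) => n no; have [/(_ n no) oa _] := wP a.
    under eq_bigr do rewrite mulrCA.
    by rewrite -mulr_sumr oa mulr0.
  by rewrite /gam mulr_sumr; apply: eq_bigr => j _; rewrite mulrCA.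
have Ed : \det (E x) @[x --> x0^'] --> \det Lam by exact: cvg_det.
move/cvgrPdist_lt : Ed => /(_ `|\det Lam|).
rewrite normr_gt0 => /(_ Lam0); apply: filterS => x Ex; apply/negP => /eqP W0.
move: Ex; rewrite /E !det_mulmx det_tr W0 mulr0 mulr0 mul0r subr0.
by rewrite ltxx.
Qed.

End Wronskian.

(** * Real-analytic functions *)

Section RealAnalytic.
Variables (R : realType) (U : set R).

Lemma real_analytic_derive1n (h : R -> R) l :
  real_analytic_on U h -> real_analytic_on U (derive1n l h).
Proof.
move=> hU x0 /hU[c hc]; exists (iter l (@pseries_diffs R) c).
exact: hasps_derive1n.
Qed.

Lemma real_analytic_is_derive (h : R -> R) l x : real_analytic_on U h -> U x ->
  is_derive x 1 (derive1n l h) (derive1n l.+1 h x).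
Proof.
move=> /(@real_analytic_derive1n _ l) hU /hU[c hc]; rewrite derive1nS.
exact: (nbhs_singleton (hasps_derive hc).1).
Qed.

Lemma real_analytic_continuous (h : R -> R) x : real_analytic_on U h -> U x ->
  {for x, continuous h}.
Proof. by move=> hU /hU[c]; exact: hasps_continuous. Qed.

Lemma real_analytic_cst (a : R) : real_analytic_on U (cst a).
Proof. by move=> x _; eexists; exact: hasps_cst. Qed.

Lemma real_analytic_mulX (h : R -> R) : real_analytic_on U h ->
  real_analytic_on U (fun x => x * h x).
Proof. by move=> hU x /hU[c]; exact: hasps_mulX. Qed.

(** The interior of the zero set is both open and closed relative to [U], which is connected. *)
Lemma real_analytic_identity (g : R -> R) x0 : is_interval U ->
  real_analytic_on U g -> U x0 -> (\forall x \near x0, g x = 0) ->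
  forall x, U x -> g x = 0.
Proof.
move=> Ui gU Ux0 gx0.
pose C := (g @^-1` [set 0])^°.
have CU : U `&` C = U `&` closure C.
  apply/seteqP; split=> [x [Ux Cx]|x [Ux Cx]]; split=> //.
    exact: subset_closure.
  have [c gc] := gU x Ux.
  (* If some Taylor coefficient at [x] were nonzero, [g] would have no zero in a punctured
     neighbourhood of [x], although [x] is a limit of interior zeros. *)
  have [c0|/existsNP[n /eqP cn]] := pselect (forall n, c n = 0).
    exact: (hasps_eq0 gc c0).
  have /Cx[y [Cy]] := hasps_neq0 gc (ex_intro _ n cn).
  move=> gy; have [yE|yx] := eqVneq (y : R) x; first by rewrite -yE.
  move: gy => /(_ yx).
  by have /= := interior_subset Cy => ->; rewrite eqxx.
have UCU : U `&` C = U.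
  have /connected_intervalP := Ui; apply.
  - by exists x0; split.
  - by exists C => //; exact: open_interior.
  - by exists (closure C) => //; exact: closed_closure.
move=> x; rewrite -UCU => -[_ Cx].
exact: (interior_subset Cx).
Qed.

Hypothesis Uo : open U.

(** A root of [Q] in [U] is also a root of [P]. Cancelling the common factor keeps the relation away
    from that root, hence also at it by continuity of [f], and lowers the degree of [Q]. *)
Lemma annihilated_rational (f : R -> R) (P Q : {poly R}) :
  (forall x, U x -> {for x, continuous f}) -> Q != 0 ->
  (forall x, U x -> P.[x] + Q.[x] * f x = 0) -> rational_on U f.
Proof.
move=> fc; have [n] := ubnP (size Q).
elim: n P Q => // n IH P Q; rewrite ltnS => sQ Q0 PQ.
have [Qn0|/existsNP[x /not_implyP[Ux /negP/negPn Qx]]] :=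
  pselect (forall x, U x -> Q.[x] != 0).
  exists (- P), Q; split => // x Ux; have := PQ x Ux; rewrite hornerN => /eqP.
  rewrite addrC addr_eq0 => /eqP fx; rewrite -fx mulrC mulKf//; exact: Qn0.
have Px : P.[x] == 0 by have := PQ x Ux; rewrite (eqP Qx) mul0r addr0 => ->.
have /factor_theorem[Q1 Q1E] : root Q x := Qx.
have /factor_theorem[P1 P1E] : root P x := Px.
have Q10 : Q1 != 0 by apply: contraNneq Q0 => Q10; rewrite Q1E Q10 mul0r.
apply: (IH P1 Q1) => //.
  by move: sQ; rewrite Q1E size_Mmonic ?monicXsubC// size_XsubC addn2.
have H y : U y -> y != x -> P1.[y] + Q1.[y] * f y = 0.
  move=> Uy yx; apply/eqP; have := PQ y Uy.
  rewrite P1E Q1E !hornerE mulrAC -mulrDl => /eqP.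
  by rewrite mulf_eq0 subr_eq0 (negbTE yx) orbF.
move=> y Uy; have [->{y Uy}|] := eqVneq y x; last exact: H.
have cF : (P1.[y] + Q1.[y] * f y) @[y --> x^'] --> P1.[x] + Q1.[x] * f x.
  apply: cvg_within_filter; apply: cvgD; first exact: continuous_horner.
  by apply: cvgM; [exact: continuous_horner|exact: fc].
have <- := cvg_lim (@Rhausdorff R) cF; apply/cvg_lim => //.
have : (fun=> 0 : R) @ x^' --> (0 : R) by exact: cvg_cst.
apply: cvg_trans; apply: near_eq_cvg; near=> y; apply/esym/H.
  by near: y; apply: nbhs_dnbhs; exact: open_nbhs_nbhs.
by near: y; exact: nbhs_dnbhs_neq.
Unshelve. all: by end_near. Qed.

Lemma poly_near_eq0 (P : {poly R}) (x0 : R) :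
  (\forall x \near x0, P.[x] = 0) -> P = 0.
Proof.
move=> /nbhs_ballP[e /= e0 H]; apply/eqP; apply: contraT => P0.
pose u k := x0 + e / k.+2%:R.
have uI : injective u.
  move=> i j /addrI /(mulfI (lt0r_neq0 e0)) /invr_inj /eqP.
  by rewrite eqr_nat => /eqP[].
have := @max_poly_roots _ P [seq u k | k <- iota 0 (size P)] P0.
rewrite size_map size_iota ltnn map_inj_uniq ?iota_uniq//; apply => //.
apply/allP => _ /mapP[k _ ->]; apply/eqP/H.
rewrite /ball/= /u opprD addNKr normrN gtr0_norm ?divr_gt0//.
by rewrite ltr_pdivrMr// ltr_pMr// ltr1n.
Qed.

End RealAnalytic.

(** * Combinations [P + Q f] with polynomial coefficients *)

Section AffineFamily.
Variables (R : realType) (f : R -> R).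

(* [1, x, ..., x^(m-1), f, x f, ..., x^(m-1) f]: a linear combination is [P + Q f]
   with [P] and [Q] of degree less than [m]. *)
Definition aff_expt (m j : nat) : nat := if (j < m)%N then j else (j - m)%N.
(** The value [y] is kept separate from [f x] so that the same row can be formed at a rational
    approximation of [f x]. *)
Definition aff (m j : nat) (x y : R) : R :=
  x ^+ aff_expt m j * (if (j < m)%N then 1 else y).
Definition afff (m j : nat) (x : R) : R := aff m j x (f x).

Lemma real_analytic_afff U m j : real_analytic_on U f ->
  real_analytic_on U (afff m j).
Proof.
rewrite /afff /aff => fU; move: (aff_expt m j) => k.
elim: k => [|k IH].
  case: (j < m)%N.
    rewrite (_ : (fun _ => _) = cst 1); first exact: real_analytic_cst.
    by apply/funext => x; rewrite expr0 mul1r.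
  rewrite (_ : (fun _ => _) = f)//.
  by apply/funext => x; rewrite expr0 mul1r.
have := real_analytic_mulX IH; congr real_analytic_on.
by apply/funext => x; rewrite mulrA exprS.
Qed.

Lemma afff_combination m (lam : 'rV[R]_(m + m)) x :
  \sum_(j < m + m) lam 0 j * afff m j x =
  (\sum_(i < m) lam 0 (lshift m i) *: 'X^i).[x] +
  (\sum_(i < m) lam 0 (rshift m i) *: 'X^i).[x] * f x.
Proof.
rewrite big_split_ord /= !horner_sum mulr_suml; congr (_ + _).
  apply: eq_bigr => i _; rewrite /afff /aff /aff_expt/= ltn_ord mulr1.
  by rewrite hornerZ hornerXn.
apply: eq_bigr => i _; rewrite /afff /aff /aff_expt/=.
by rewrite ltnNge leq_addr /= addKn hornerZ hornerXn mulrA.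
Qed.

Lemma sum_scale_Xn_eq0 m (a : 'I_m -> R) :
  \sum_(i < m) a i *: 'X^i = 0 -> forall i, a i = 0.
Proof.
move=> /polyP H i; have := H i; rewrite coef0 coef_sum => <-.
rewrite (bigD1 i)//= coefZ coefXn eqxx mulr1 big1 ?addr0// => k ki.
by rewrite coefZ coefXn val_eqE eq_sym (negbTE ki) mulr0.
Qed.

(** A linear relation between the Taylor coefficients at [x0] spreads to [P + Q f = 0] on [U] by the
    identity theorem. Since [f] is not rational, [Q = 0], and then [P = 0]; so the family is
    free. *)
Lemma afff_wronskian_isolated_zeros (U : set R) m x0 : open U -> is_interval U ->
  real_analytic_on U f -> ~ rational_on U f -> U x0 ->
  \forall x \near x0^', \det (wronskian_mx (fun j : 'I_(m + m) => afff m j) x) != 0.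
Proof.
move=> Uo Ui fU fnr Ux0.
have /choice[c cP] : forall j : 'I_(m + m), exists c, hasps x0 c (afff m j).
  by move=> j; exact: (real_analytic_afff m j fU).
apply: (wronskian_isolated_zeros cP) => lam lam0.
pose g x := \sum_(j < m + m) lam 0 j * afff m j x.
have gU : real_analytic_on U g.
  move=> x Ux; have /choice[d dP] : forall j : 'I_(m + m), exists c, hasps x c (afff m j).
    by move=> j; exact: (real_analytic_afff m j fU).
  exists (fun n => \sum_(j < m + m) lam 0 j * d j n).
  apply: (@hasps_sum _ _ _ _ _ (fun j n => lam 0 j * d j n)
    (fun j x => lam 0 j * afff m j x)) => j _.
  exact: haspsZ.
have gx0 : \forall x \near x0, g x = 0.
  apply: hasps_eq0 lam0.
  apply: (@hasps_sum _ _ _ _ _ (fun j n => lam 0 j * c j n)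
    (fun j x => lam 0 j * afff m j x)) => j _.
  exact: haspsZ.
have g0 := real_analytic_identity Ui gU Ux0 gx0.
set P := \sum_(i < m) lam 0 (lshift m i) *: 'X^i.
set Q := \sum_(i < m) lam 0 (rshift m i) *: 'X^i.
have gE x : g x = P.[x] + Q.[x] * f x by rewrite /g afff_combination.
have Q0 : Q = 0.
  apply: contrapT => /eqP Q0; apply: fnr.
  apply: (@annihilated_rational _ U Uo f P Q) => // [x|x /g0].
    exact: real_analytic_continuous.
  by rewrite gE.
have P0 : P = 0.
  apply: (@poly_near_eq0 _ P x0); apply: filterS gx0 => x.
  by rewrite gE Q0 horner0 mul0r addr0.
apply/rowP => j; rewrite mxE; case: (split_ordP j) => i ->.
  exact: (sum_scale_Xn_eq0 P0).
exact: (sum_scale_Xn_eq0 Q0).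
Qed.

End AffineFamily.

(** * Divided differences *)

Section DividedDifferences.
Variable R : realType.
Implicit Types (G : nat -> R -> R) (a b : R) (x : nat -> R).

Lemma iterated_Rolle G a b :
  (forall k t, a <= t <= b -> is_derive t 1 (G k) (G k.+1 t)) ->
  forall n k x, (forall i, (i < n)%N -> x i < x i.+1) ->
  (forall i, (i <= n)%N -> a <= x i <= b /\ G k (x i) = 0) ->
  exists2 t, a <= t <= b & G (n + k)%N t = 0.
Proof.
move=> dG; elim=> [|n IH] k x xlt x0.
  by have [xab Gx] := x0 0%N (leqnn _); exists (x 0%N).
(* Rolle's theorem between consecutive zeros; beyond the last gap the value 0 only serves to make
   [y] a total sequence. *)
have : forall i, exists y, (i <= n)%N -> x i < y < x i.+1 /\ G k.+1 y = 0.
  move=> i; have [ni|in_] := ltnP n i; first by exists 0.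
  have [xi Gi] := x0 i (leqW in_); have [xi1 Gi1] := x0 i.+1 in_.
  have dGi t : x i <= t <= x i.+1 -> is_derive t 1 (G k) (G k.+1 t).
    move=> /andP[it ti]; apply: dG.
    by rewrite (le_trans _ it) ?(le_trans ti)//; [case/andP: xi1|case/andP: xi].
  have [|t|||y yi dy] := @Rolle R (G k) (x i) (x i.+1).
  - exact: xlt.
  - rewrite in_itv /= => /andP[/ltW it /ltW ti].
    by have := dGi t; rewrite it ti => /(_ isT)[].
  - apply: derivable_within_continuous => t; rewrite in_itv /= => /dGi dGt.
    by have [] := dGt.
  - by rewrite Gi Gi1.
  exists y => _; split; first by move: yi; rewrite in_itv.
  move: yi; rewrite in_itv /= => /andP[/ltW iy /ltW yi1].
  have dy' := dGi y; rewrite iy yi1 in dy'; have {}dy' := dy' isT.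
  by rewrite -(@derive_val _ _ _ _ _ _ _ dy') (@derive_val _ _ _ _ _ _ _ dy).
move=> /choice[y yP]; rewrite addSnnS; apply: (IH k.+1 y).
  move=> i in_; have [/andP[_ yx] _] := yP i (ltnW in_).
  by have [/andP[xy _] _] := yP i.+1 in_; exact: lt_trans xy.
move=> i in_; have [/andP[/ltW xy /ltW yx] Gy] := yP i in_; split => //.
have [/andP[ax _] _] := x0 i (leqW in_); have [/andP[_ xb] _] := x0 i.+1 in_.
by rewrite (le_trans ax xy) (le_trans yx xb).
Qed.

(* Coefficient of [h (x k)] in the divided difference [h[x 0, ..., x n]]. *)
Definition ddcoef x (n k : nat) : R :=
  \prod_(j < n.+1 | j != k :> nat) (x k - x j)^-1.

Lemma is_derive_horner (p : {poly R}) (t : R) :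
  is_derive t 1 (horner p) (p^`()%R).[t].
Proof.
apply: DeriveDef; first exact: derivable_horner.
by rewrite -derive1E -derivE.
Qed.

(** The difference between [G 0] and its Lagrange interpolant [p] has [n.+1] zeros, so its
    derivative of order [n] vanishes somewhere. That derivative of [p] is constant, equal to [n!]
    times the divided difference. *)
Lemma divided_difference_mvt G a b n x :
  (forall k t, a <= t <= b -> is_derive t 1 (G k) (G k.+1 t)) ->
  (forall i, (i < n)%N -> x i < x i.+1) ->
  (forall i, (i <= n)%N -> a <= x i <= b) ->
  exists2 t, a <= t <= b &
    \sum_(k < n.+1) ddcoef x n k * G 0%N (x k) = G n t / n`!%:R.
Proof.
move=> dG xlt xab.
have xlt2 i j : (i < j)%N -> (j <= n)%N -> x i < x j.
  elim: j => // j IHj; rewrite ltnS leq_eqVlt => /orP[/eqP ->|ij] jn.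
    exact: xlt.
  by apply: lt_trans (IHj ij (ltnW jn)) _; exact: xlt.
have xneq (i j : 'I_n.+1) : i != j -> x i - x j != 0.
  rewrite subr_eq0 -val_eqE /= neq_ltn => /orP[ij|ji].
    by rewrite lt_eqF// xlt2// -ltnS.
  by rewrite gt_eqF// xlt2// -ltnS.
pose q (k : 'I_n.+1) : {poly R} := \prod_(j < n.+1 | j != k) ('X - (x j)%:P).
pose p : {poly R} := \sum_(k < n.+1) (ddcoef x n k * G 0%N (x k)) *: q k.
have sq k : size (q k) = n.+1.
  rewrite /q size_prod => [|j _]; last by rewrite polyXsubC_eq0.
  under eq_bigr do rewrite size_XsubC.
  by rewrite sum_nat_const cardC1 card_ord /=; lia.
have qn k : (q k)`_n = 1.
  have /monicP : q k \is monic by exact: monic_prod_XsubC.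
  by rewrite lead_coefE sq.
have pn : p`_n = \sum_(k < n.+1) ddcoef x n k * G 0%N (x k).
  by rewrite /p coef_sum; apply: eq_bigr => k _; rewrite coefZ qn mulr1.
have px (k : 'I_n.+1) : p.[x k] = G 0%N (x k).
  rewrite /p horner_sum (bigD1 k)//= big1 ?addr0 => [|i ik]; last first.
    apply/eqP; rewrite hornerZ mulf_eq0; apply/orP; right; rewrite /q horner_prod.
    by apply/prodf_eq0; exists k; rewrite 1?eq_sym// !hornerE subrr.
  rewrite hornerZ /q horner_prod mulrAC /ddcoef -big_split /= big1 ?mul1r//.
  by move=> j jk; rewrite !hornerE mulVf// xneq// eq_sym.
have sp : (size p <= n.+1)%N.
  apply: leq_trans (size_sum _ _ _) _; apply/bigmax_leqP => k _.
  by apply: leq_trans (size_scale_leq _ _) _; rewrite sq.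
have pdn t : (p^`(n)%R).[t] = p`_n * n`!%:R.
  have -> : (p^`(n)%R) = (p`_n * n`!%:R)%:P.
    apply/polyP => -[|i]; rewrite coef_derivn coefC /=.
      by rewrite addn0 ffactnn mulr_natr.
    by rewrite nth_default ?mul0rn// (leq_trans sp)// addnS ltnS leq_addr.
  by rewrite hornerC.
have dp k (t : R) : is_derive t 1 (horner (p^`(k)%R)) (p^`(k.+1)%R).[t].
  by rewrite derivnS; exact: is_derive_horner.
have [|i in_|t tab] := @iterated_Rolle (fun k t => G k t - (p^`(k)%R).[t]) a b _ n 0%N x xlt.
- by move=> k t tab; exact: (is_deriveB (dG k t tab) (dp k t)).
- split; first exact: xab.
  by rewrite derivn0 (px (Ordinal (in_ : (i < n.+1)%N))) subrr.
rewrite addn0 pdn => /eqP; rewrite subr_eq0 => /eqP Gt.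
exists t => //; rewrite -pn Gt mulfK// pnatr_eq0 gtn_eqF// fact_gt0.
Qed.

(** Left multiplication by this matrix turns rows of values at the points [x k] into divided
    differences; its determinant is the inverse of the Vandermonde product. *)
Definition ddmx x N : 'M[R]_N :=
  \matrix_(i < N, k < N) if (k <= i)%N then ddcoef x i k else 0.

Lemma det_ddmx x N : \det (ddmx x N) = \prod_(i < N) ddcoef x i i.
Proof.
rewrite det_trig; first by apply: eq_bigr => i _; rewrite mxE leqnn.
by apply/is_trig_mxP => i j ij; rewrite mxE leqNgt ij.
Qed.

Lemma sum_ddmx x N (i : 'I_N) (h : nat -> R) :
  \sum_(k < N) ddmx x N i k * h k = \sum_(k < i.+1) ddcoef x i k * h k.
Proof.
rewrite (@big_ord_widen _ _ _ i.+1 N (fun k => ddcoef x i k * h k))//.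
rewrite [RHS]big_mkcond; apply: eq_bigr => k _; rewrite mxE ltnS.
by case: ifP => //; rewrite mul0r.
Qed.

End DividedDifferences.

(** * Few near-rational points in a short window *)

Section FewNearRationalPoints.
Variable R : realType.

Lemma sum_ord_double n : ((\sum_(i < n) i) * 2 = n * n.-1)%N.
Proof.
elim: n => [|n IH]; first by rewrite big_ord0.
by rewrite big_ord_recr /=; move: (\sum_(i < n) i)%N IH => S; case: n => [|n] /=; nia.
Qed.

Lemma sum_aff_expt m : (\sum_(j < m + m) aff_expt m j = m * m.-1)%N.
Proof.
rewrite -sum_ord_double big_split_ord /= muln2 -addnn; congr (_ + _)%N.
  by apply: eq_bigr => i _; rewrite /aff_expt ltn_ord.
by apply: eq_bigr => i _; rewrite /aff_expt ltnNge leq_addr /= addKn.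
Qed.

(* Column [j] has common denominator [Q ^ aff_expt m j] and row [k] has common
   denominator [b k]; clearing columns rather than rows is what makes the
   exponent of [Q] only [m * m.-1]. *)
Lemma det_aff_rational_ge m (p a : 'I_(m + m) -> int) (b : 'I_(m + m) -> nat) (Q : nat) :
  let M := \matrix_(k, j) aff m j ((p k)%:~R / Q%:R) ((a k)%:~R / (b k)%:R) : 'M[R]_(m + m) in
  (forall k, (0 < b k)%N) -> (0 < Q)%N -> \det M != 0 ->
  1 <= `|\det M| * \prod_k (b k)%:R * Q%:R ^+ (m * m.-1).
Proof.
move=> M b0 Q0 M0.
(* After clearing denominators the determinant is a nonzero integer, hence at least 1 in absolute
   value. *)
pose Z : 'M[int]_(m + m) := \matrix_(k, j)
  ((p k) ^+ aff_expt m j * (if (j < m)%N then (b k : int) else a k)).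
have bn0 k : (b k)%:R != 0 :> R by rewrite pnatr_eq0 -lt0n.
have Qn0 : Q%:R != 0 :> R by rewrite pnatr_eq0 -lt0n.
have ZE : map_mx intr Z = diag_mx (\row_k (b k)%:R) *m M *m
    diag_mx (\row_j Q%:R ^+ aff_expt m j) :> 'M[R]_(m + m).
  apply/matrixP => k j; rewrite mul_mx_diag mul_diag_mx !mxE /aff.
  rewrite rmorphM rmorphXn /= expr_div_n.
  by case: (j < m)%N; field; rewrite ?bn0 expf_neq0.
have := det_map_mx (intr : {rmorphism int -> R}) Z; rewrite ZE !det_mulmx !det_diag.
have -> : \prod_(j < m + m) (\row_(j0 < m + m) (Q%:R ^+ aff_expt m j0 : R)) 0 j =
    Q%:R ^+ (m * m.-1).
  by under eq_bigr do rewrite mxE; rewrite -expr_sum sum_aff_expt.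
under eq_bigr do rewrite mxE.
move=> dE; rewrite [`|_| * _]mulrC -[X in X * _ * _]ger0_norm ?prodr_ge0//.
rewrite -normrM -[X in _ * X](@ger0_norm _ (_ ^+ _)) ?exprn_ge0// -normrM dE.
rewrite -intr_norm ler1z -gtz0_ge1 normr_gt0; apply/eqP => dZ0; move: dE.
rewrite dZ0 => /eqP; rewrite !mulf_eq0 (negbTE M0) orbF expf_eq0 (negbTE Qn0).
by rewrite andbF orbF => /prodf_eq0[k _]; rewrite (negbTE (bn0 k)).
Qed.

Lemma prod_neq_const (q : R) (n k : nat) : (k <= n)%N ->
  \prod_(j < n.+1 | j != k :> nat) q = q ^+ n.
Proof.
move=> kn; rewrite (eq_bigl (mem (predC1 (Ordinal (kn : (k < n.+1)%N)))))//.
by rewrite prodr_const cardC1 card_ord.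
Qed.

Lemma normr_ddcoef_le (x : nat -> R) n k (q : R) : 0 < q -> (k <= n)%N ->
  (forall j, (j <= n)%N -> j != k -> q^-1 <= `|x k - x j|) ->
  `|ddcoef x n k| <= q ^+ n.
Proof.
move=> q0 kn xq; rewrite /ddcoef normr_prod -(prod_neq_const q kn).
apply: ler_prod => j jk; rewrite normr_ge0 normfV /=.
have := xq j; rewrite -ltnS => /(_ (ltn_ord j) jk) xqj.
rewrite -[leRHS]invrK lef_pV2// posrE ?invr_gt0//.
by apply: lt_le_trans xqj; rewrite invr_gt0.
Qed.

Lemma normr_ddcoef_ge (x : nat -> R) n k (q : R) : 0 < q -> (k <= n)%N ->
  (forall j, (j <= n)%N -> j != k -> 0 < `|x k - x j| <= q^-1) ->
  q ^+ n <= `|ddcoef x n k|.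
Proof.
move=> q0 kn xq; rewrite /ddcoef normr_prod -(prod_neq_const q kn).
apply: ler_prod => j jk; rewrite (ltW q0) normfV /=.
have := xq j; rewrite -ltnS => /(_ (ltn_ord j) jk)/andP[x0 xqj].
by rewrite -[leLHS]invrK lef_pV2// posrE ?invr_gt0.
Qed.

Lemma near_nat_gt (a : R) : \forall T \near \oo, a < T%:R.
Proof.
near=> T; apply: (@lt_le_trans _ _ (Num.bound `|a|)%:R).
  exact: (le_lt_trans (ler_norm _) (archi_boundP (normr_ge0 a))).
by rewrite ler_nat; near: T; exact: nbhs_infty_ge.
Unshelve. all: by end_near. Qed.


Lemma aff_dist_le m j (x y y' : R) (C : R) : `|x| <= C -> 1 <= C -> (j < m + m)%N ->
  `|aff m j x y - aff m j x y'| <= C ^+ m * `|y - y'|.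
Proof.
move=> xC C1 jm; have em : (aff_expt m j <= m)%N.
  by rewrite /aff_expt; case: ifP => [/ltnW//|_]; rewrite leq_subLR ltnW.
rewrite /aff -mulrBr normrM; apply: ler_pM => //.
  rewrite normrX; apply: le_trans (lerXn2r _ _ _ xC) _; rewrite ?nnegrE//.
    by rewrite (le_trans _ C1).
  exact: ler_weXn2l.
by case: (j < m)%N; rewrite ?subrr ?normr0.
Qed.

(** Two estimates conflict: [ddmx x N *m M] is entrywise close to the matrix of Taylor coefficients
    at [z], so its determinant is bounded; but [\det (ddmx x N)] is so large that [\det M] would be
    smaller than its denominator allows. *)
Lemma few_near_rational_points (U : set R) (f : R -> R) (z : R) m :
  open U -> real_analytic_on U f -> U z -> (0 < m)%N ->
  \det (wronskian_mx (fun j : 'I_(m + m) => afff f m j) z) != 0 ->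
  \forall T \near \oo, forall (p a : nat -> int) (b : nat -> nat) (x : nat -> R),
    (forall k, x k = (p k)%:~R / (T ^ 8)%:R) ->
    (forall k, (k.+1 < m + m)%N -> p k < p k.+1) ->
    (forall k, (k < m + m)%N -> z <= x k <= z + ((T ^ 7)%:R)^-1) ->
    (forall k, (k < m + m)%N -> (T ^ m <= b k <= T ^ m.+1)%N) ->
    (forall k, (k < m + m)%N -> `|f (x k) - (a k)%:~R / (b k)%:R| <= (b k)%:R ^- 30) ->
    False.
Proof.
move=> Uo fU Uz m0 W0.
set N := (m + m)%N.
pose v (j : 'I_N) := afff f m j.
have vU j : real_analytic_on U (v j) by exact: real_analytic_afff.
pose D (i j : 'I_N) (t : R) : R := derive1n i (v j) t / i`!%:R.
pose A : 'M[R]_N := \matrix_(i, j) D i j z.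
have A0 : \det A != 0.
  have -> : A = diag_mx (\row_i (i`!%:R)^-1) *m wronskian_mx v z.
    by apply/matrixP => i j; rewrite mul_diag_mx !mxE mulrC.
  rewrite det_mulmx det_diag mulf_neq0//; apply/prodf_neq0 => i _.
  by rewrite mxE invr_eq0 pnatr_eq0 gtn_eqF// fact_gt0.
(* Within [eta] of [A] entrywise, a determinant is nonzero and less than [2 * |\det A|]. *)
have [|eta eta0 etaP] := @det_near _ _ A `|\det A|; first by rewrite normr_gt0.
have [r r0 rP] : exists2 r : R, 0 < r & forall t, `|t - z| < r ->
    U t /\ forall i j, `|D i j t - D i j z| < eta / 2.
  have : \forall t \near z, U t /\ forall i j, `|D i j t - D i j z| < eta / 2.
    apply: filterI; first exact: open_nbhs_nbhs.
    apply: (@filter_forall _ _ _ (nbhs z)) => i; apply: (@filter_forall _ _ _ (nbhs z)) => j.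
    have : D i j t @[t --> z] --> D i j z.
      apply: cvgM; last exact: cvg_cst.
      by apply: (@real_analytic_continuous _ U) => //; exact: real_analytic_derive1n.
    move=> /cvgrPdist_lt /(_ (eta / 2)); rewrite divr_gt0// => /(_ isT).
    by apply: filterS => t; rewrite distrC.
  move=> /nbhs_ballP[r /= r0 rP]; exists r => // t tz; apply: rP.
  by rewrite /ball/= distrC.
pose C : R := `|z| + 1.
have C1 : 1 <= C by rewrite lerDr.
near=> T; move=> p a b x xE plt xz bT fb.
have T1 : 1 <= T%:R :> R by apply/ltW; near: T; exact: near_nat_gt.
have T0 : 0 < T%:R :> R by exact: lt_le_trans T1.
have Tr : r^-1 < T%:R by near: T; exact: near_nat_gt.
have TC : N%:R * C ^+ m / (eta / 2) < T%:R by near: T; exact: near_nat_gt.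
have TA : 2 * `|\det A| < T%:R by near: T; exact: near_nat_gt.
have T7 : ((T ^ 7)%:R)^-1 <= (T%:R)^-1 :> R.
  rewrite lef_pV2 ?posrE// natrX ?exprn_gt0//.
  by rewrite -[leLHS]expr1; apply: ler_weXn2l.
have T7r : ((T ^ 7)%:R)^-1 < r.
  apply: le_lt_trans T7 _; rewrite -[ltRHS]invrK ltf_pV2 ?posrE ?invr_gt0//.
have T7C : ((T ^ 7)%:R)^-1 <= 1 :> R.
  by apply: le_trans T7 _; rewrite invf_le1.
have inU t : z <= t <= z + ((T ^ 7)%:R)^-1 -> `|t - z| < r.
  move=> /andP[zt tz]; rewrite ger0_norm ?subr_ge0//.
  by apply: le_lt_trans T7r; rewrite lerBlDl.
have plt2 i j : (i < j)%N -> (j < N)%N -> p i + 1 <= p j.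
  elim: j => // j IHj; rewrite ltnS leq_eqVlt => /orP[/eqP ->|ij] jn.
    by rewrite -ltzD1 ltrD2r plt.
  apply: le_trans (IHj ij (ltnW jn)) _; exact/ltW/plt.
have Q0 : 0 < (T ^ 8)%:R :> R by rewrite natrX exprn_gt0.
have xsep2 i j : (i < j)%N -> (j < N)%N -> ((T ^ 8)%:R)^-1 <= x j - x i.
  move=> ij jN; rewrite !xE -mulrBl -[leLHS]mul1r ler_pM2r ?invr_gt0//.
  by rewrite -intrB -[1]/(1%:~R) ler_int lerBrDl plt2.
have xsep i j : i != j -> (i < N)%N -> (j < N)%N ->
    ((T ^ 8)%:R)^-1 <= `|x i - x j| <= ((T ^ 7)%:R)^-1.
  move=> ij iN jN; apply/andP; split.
    move: ij; rewrite neq_ltn => /orP[ij|ji].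
      by rewrite distrC; apply: le_trans (xsep2 _ _ ij jN) (ler_norm _).
    by apply: le_trans (xsep2 _ _ ji iN) (ler_norm _).
  have /andP[zi iz] := xz i iN; have /andP[zj jz] := xz j jN.
  by rewrite ler_norml; apply/andP; split; lra.
have xlt i : (i.+1 < N)%N -> x i < x i.+1.
  by move=> iN; rewrite !xE ltr_pM2r ?invr_gt0// ltr_int plt.
pose M : 'M[R]_N := \matrix_(k, j) aff m j (x k) ((a k)%:~R / (b k)%:R).
have entry i j : `|(ddmx x N *m M) i j - A i j| < eta.
  have iN := ltn_ord i.
  (* The first sum is a divided difference of [v j], hence [D i j t] for some [t] in the window; the
     second is the error of replacing [f (x k)] by [a k / b k]. *)
  have -> : (ddmx x N *m M) i j = \sum_(k < i.+1) ddcoef x i k * v j (x k) +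
      \sum_(k < i.+1) ddcoef x i k * (aff m j (x k) ((a k)%:~R / (b k)%:R) - v j (x k)).
    rewrite mxE -big_split /=.
    transitivity (\sum_(k < i.+1) ddcoef x i k * aff m j (x k) ((a k)%:~R / (b k)%:R)).
      rewrite -(sum_ddmx x i (fun k => aff m j (x k) ((a k)%:~R / (b k)%:R))).
      by apply: eq_bigr => k _; rewrite [M _ _]mxE.
    by apply: eq_bigr => k _; rewrite -mulrDr addrC subrK.
  have [|k ki|k ki|t tz ->] := @divided_difference_mvt _ (fun l => derive1n l (v j))
    z (z + ((T ^ 7)%:R)^-1) i x.
  - by move=> k t /inU /rP[Ut _]; exact: real_analytic_is_derive.
  - by apply: xlt; rewrite (leq_trans _ iN).
  - by apply: xz; rewrite (leq_ltn_trans ki).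
  rewrite addrAC; apply: le_lt_trans (ler_normD _ _) _.
  rewrite [eta]splitr ltr_leD//.
    by rewrite [A _ _]mxE; have /rP[_] := inU t tz; apply.
  apply: le_trans (ler_norm_sum _ _ _) _.
  have term (k : 'I_i.+1) : `|ddcoef x i k * (aff m j (x k) ((a k)%:~R / (b k)%:R) - v j (x k))|
      <= C ^+ m / T%:R.
    have kN : (k < N)%N by rewrite (leq_trans (ltn_ord k)).
    have /andP[zk kz] := xz k kN.
    have xC : `|x k| <= C.
      rewrite -[x k](subrK z) addrC; apply: le_trans (ler_normD _ _) _.
      by rewrite lerD2l ger0_norm ?subr_ge0//; lra.
    have := @aff_dist_le m j _ ((a k)%:~R / (b k)%:R) (f (x k)) _ xC C1 (ltn_ord j).
    rewrite -/(afff f m j (x k)) => affle.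
    have /andP[Tb _] := bT k kN.
    have b0 : 0 < (b k)%:R :> R.
      by rewrite ltr0n (leq_trans _ Tb)// expn_gt0 -(ltr0n R) T0.
    have fle : `|(a k)%:~R / (b k)%:R - f (x k)| <= T%:R ^- (m * 30).
      rewrite distrC; apply: le_trans (fb k kN) _.
      rewrite lef_pV2 ?posrE ?exprn_gt0// exprM; apply: lerXn2r.
      - by rewrite nnegrE exprn_ge0// (ltW T0).
      - by rewrite nnegrE (ltW b0).
      - by rewrite -natrX ler_nat.
    (* Since [i < 2m], this factor is at most [T^(16m - 8)], while the approximation error is at
       most [T^(-30m)]; a factor [1 / T] remains to absorb constants. *)
    have dle : `|ddcoef x i k| <= (T ^ 8)%:R ^+ i.
      apply: normr_ddcoef_le => //; first by rewrite -ltnS.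
      move=> l li lk; have lN : (l < N)%N by rewrite (leq_ltn_trans li).
      by have := xsep k l; rewrite eq_sym lk kN lN => /(_ isT isT isT)/andP[].
    rewrite normrM; apply: le_trans (ler_pM _ _ dle affle) _ => //.
    rewrite mulrCA ler_wpM2l ?exprn_ge0 ?(le_trans _ C1)//.
    apply: le_trans (ler_wpM2l _ fle) _; first by rewrite exprn_ge0.
    rewrite ler_pdivrMr ?exprn_gt0// natrX -exprM mulrC ler_pdivlMr//.
    rewrite -exprSr; apply: ler_weXn2l => //.
    by move: iN; rewrite /N; move: (nat_of_ord i) => i'; clear; lia.
  apply: le_trans (ler_sum _ (fun k _ => term k)) _.
  rewrite sumr_const card_ord -[_ *+ i.+1]mulr_natl.
  apply: (@le_trans _ _ (N%:R * (C ^+ m / T%:R))).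
    by rewrite ler_wpM2r ?ler_nat// divr_ge0 ?exprn_ge0 ?(le_trans _ C1)//.
  by rewrite mulrA ler_pdivrMr// [leRHS]mulrC -ler_pdivrMr ?divr_gt0// ltW.
have dM := etaP _ entry.
have dLM0 : \det (ddmx x N *m M) != 0.
  by apply/eqP => d0; move: dM; rewrite d0 sub0r normrN ltxx.
have dLM : `|\det (ddmx x N *m M)| < T%:R.
  apply: lt_trans TA; rewrite -[X in `|X|](subrK (\det A)).
  apply: le_lt_trans (ler_normD _ _) _.
  by rewrite mulrDl mul1r ltrD2r.
move: dLM0 dLM; rewrite det_mulmx mulf_eq0 negb_or => /andP[_ M0].
rewrite normrM => dLM.
(* All points lie in a window of length [T^-7], so each of the [N(N-1)/2] differences contributes at
   least [T^7]. *)
have dL : T%:R ^+ (7 * \sum_(i < N) i) <= `|\det (ddmx x N)|.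
  rewrite det_ddmx normr_prod big_distrr /= expr_sum.
  apply: ler_prod => i _; rewrite exprn_ge0 ?(ltW T0)//= exprM -natrX.
  apply: normr_ddcoef_ge => //; first by rewrite natrX exprn_gt0.
  move=> l li lk; have lN : (l < N)%N by rewrite (leq_ltn_trans li)// ltn_ord.
  have := xsep i l; rewrite eq_sym lk ltn_ord lN => /(_ isT isT isT) /andP[xi ->].
  by rewrite andbT; apply: lt_le_trans xi; rewrite invr_gt0.
have bpos (k : 'I_N) : (0 < b k)%N.
  by have /andP[Tb _] := bT k (ltn_ord k); rewrite (leq_trans _ Tb)// expn_gt0 -(ltr0n R) T0.
have Qpos : (0 < T ^ 8)%N by rewrite -(ltr0n R).
have ME : M = \matrix_(k, j) aff m j ((p k)%:~R / (T ^ 8)%:R) ((a k)%:~R / (b k)%:R).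
  by apply/matrixP => k j; rewrite !mxE xE.
rewrite ME in M0 dLM.
have := @det_aff_rational_ge m (fun k => p k) (fun k => a k) (fun k => b k) (T ^ 8) bpos Qpos M0.
apply/negP; rewrite -ltNge.
have bprod : \prod_(k < N) (b k)%:R <= T%:R ^+ (m.+1 * N) :> R.
  rewrite exprM -[X in _ ^+ X]card_ord -prodr_const; apply: ler_prod => k _.
  by have /andP[_ bk] := bT k (ltn_ord k); rewrite ler0n -natrX ler_nat.
rewrite -[ltLHS]mulrA; set X := (X in `|_| * X).
have X0 : 0 <= X by rewrite mulr_ge0 ?exprn_ge0// prodr_ge0.
have XT : X <= T%:R ^+ (m.+1 * N + 8 * (m * m.-1)).
  by rewrite exprD ler_pM ?prodr_ge0 ?exprn_ge0// natrX -exprM.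
have XdL : X * T%:R <= `|\det (ddmx x N)|.
  apply: le_trans dL; apply: le_trans (ler_wpM2r (ltW T0) XT) _.
  rewrite -exprSr; apply: ler_weXn2l => //.
  (* The exponents compare as [2m(m+1) + 8m(m-1) + 1 <= 7m(2m-1)], which holds for [m >= 1]. *)
  have := sum_ord_double N; rewrite /N; move: (\sum_(i < m + m) i)%N => S1.
  by move: m0; clear; case: m => // m' _ /=; nia.
rewrite -(ltr_pM2r T0) mul1r -mulrA; apply: le_lt_trans dLM.
by rewrite mulrC ler_wpM2r.
Unshelve. all: by end_near. Qed.

End FewNearRationalPoints.

(** * Avoiding neighbourhoods of rationals *)

Section GenericPoint.
Variable R : realType.
Notation mu := (@lebesgue_measure R).

(** By countable subadditivity, sets of total measure at most [s] cannot cover an interval longer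
    than [s]. *)
Lemma interval_not_covered (E : nat -> set R) (e : nat -> R) (u v s : R) :
  (forall n, measurable (E n)) -> (forall n, (mu (E n) <= (e n)%:E)%E) ->
  (forall n, \sum_(0 <= i < n) e i <= s) -> s < v - u ->
  exists z, u < z < v /\ forall n, ~ E n z.
Proof.
move=> mE muE es suv; apply: contrapT => H.
have uv_cover : `]u, v[%classic `<=` \bigcup_n E n.
  move=> z; rewrite /= in_itv /= => zuv; apply: contrapT => Ez; apply: H; exists z.
  by split => // n En; apply: Ez; exists n.
have := measure_sigma_subadditive mu mE (measurable_itv _) uv_cover.
apply/negP; rewrite -ltNge.
have s0 : 0 <= s by have := es 0%N; rewrite big_nil.
rewrite [X in (_ < X)%E](lebesgue_measure_itv `]u, v[) /= lte_fin -subr_gt0 (le_lt_trans s0 suv).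
apply: (@le_lt_trans _ _ s%:E); last by rewrite -EFinB lte_fin.
apply: lime_le; first exact: is_cvg_nneseries.
apply: nearW => n; apply: (@le_trans _ _ (\sum_(0 <= i < n) (e i)%:E)%E).
  by apply: lee_sum => i _; exact: muE.
by rewrite sumEFin lee_fin.
Qed.

(** By compactness, finitely many neighbourhoods, each meeting [P] at most in its base point, cover
    the segment. *)
Lemma finite_isolated (u v : R) (P : set R) :
  (forall x, u <= x <= v -> \forall y \near x^', ~ P y) ->
  finite_set (`[u, v]%classic `&` P).
Proof.
move=> iso; have := @segment_compact R u v; rewrite compact_cover.
pose g x := [set y | y != x -> ~ P y]^°.
move=> /(_ R `[u, v]%classic g)[].
- by move=> x _; exact: open_interior.
- move=> x xuv; exists x => //.
  by have := iso x; rewrite /= in_itv in xuv; exact.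
move=> D _ uvD.
apply: (sub_finite_set _ (finite_fset D)) => x [/uvD[y Dy gy] Px].
have [->//|xy] := eqVneq x y.
by have /= := interior_subset gy xy.
Qed.

Lemma sum_inv_sqr_le n : \sum_(0 <= i < n) (i%:R ^- 2 : R) <= 2.
Proof.
case: n => [|[|n]]; first by rewrite big_nil.
  by rewrite big_nat1 expr0n invr0.
(* Telescoping bound; the term at [i = 0] is 0 because the inverse of 0 is 0. *)
suff : \sum_(0 <= i < n.+2) (i%:R ^- 2 : R) <= 2 - n.+1%:R^-1.
  by move=> /le_trans; apply; rewrite gerBl invr_ge0.
elim: n => [|n IH].
  by rewrite big_nat_recr//= big_nat1 expr0n invr0 add0r expr1n invr1; lra.
rewrite big_nat_recr//=; apply: le_trans (lerD IH (lexx _)) _.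
set y := n.+1%:R; have y0 : 0 < y by rewrite ltr0n.
have -> : n.+2%:R = y + 1 :> R by rewrite -natr1.
rewrite -subr_ge0.
have -> : 2 - (y + 1)^-1 - (2 - y^-1 + (y + 1) ^- 2) = y^-1 * (y + 1)^-2 :> R.
  by field; rewrite !gt_eqF// addr_gt0.
by rewrite mulr_ge0// invr_ge0 ?exprn_ge0 ?addr_ge0 ?ltW.
Qed.

(** For each [b], about [b] fractions [a / b] lie near the range of [f], and each excludes a set of
    length of order [rho b / c0] by the lower Lipschitz bound. As [rho b] is at most [th / b^3], the
    total is a convergent sum. *)
Lemma generic_point (f : R -> R) (u v c0 th : R) (F B : nat) (rho : nat -> R) (Z : set R) :
  u < v -> 0 < c0 ->
  (forall x y, u <= x <= v -> u <= y <= v -> c0 * `|x - y| <= `|f x - f y|) ->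
  (forall x, u <= x <= v -> `|f x| <= F%:R) ->
  (0 < B)%N ->
  (forall b, (B <= b)%N -> 0 <= rho b <= 1 /\ rho b * b%:R ^+ 3 <= th) ->
  countable Z -> 24 * F.+1%:R * th / c0 < v - u ->
  exists z, [/\ u < z < v, ~ Z z &
    forall b (a : int), (B <= b)%N -> rho b < `|f z - a%:~R / b%:R|].
Proof.
move=> uv c00 fc fF B0 rhoP Zc thuv.
pose S b (a : int) x := u <= x <= v /\ `|f x - a%:~R / b%:R| <= rho b.
have /choice[c cP] : forall ba : nat * int, exists c, (exists x, S ba.1 ba.2 x) -> S ba.1 ba.2 c.
  move=> ba; have [[x Sx]|nS] := pselect (exists x, S ba.1 ba.2 x).
    by exists x.
  by exists 0 => /nS.
(* Only numerators with [|a| <= b * F.+1] matter, since [|f| <= F] and [rho b <= 1]; [ix b]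
   enumerates these [K b] integers. *)
pose K b := (2 * (b * F.+1)).+1.
pose ix b (i : nat) : int := i%:Z - (b * F.+1)%:Z.
(* Two points of [S b a] have images within [2 * rho b] of each other, so an interval around any one
   of them contains them all. *)
pose J b i : set R := `[c (b, ix b i) - 2 * rho b / c0, c (b, ix b i) + 2 * rho b / c0]%classic.
(* Index 0 is free because [B > 0]; it carries the null set [Z], with [e 0 = 0]. *)
pose E b := if b is 0%N then Z else
  if (b < B)%N then set0 else \big[setU/set0]_(i < K b) J b i.
pose e b := 12 * F.+1%:R * th / c0 * b%:R ^- 2.
have th0 : 0 <= th.
  by have [/andP[r0 _]] := rhoP B (leqnn _); apply: le_trans; rewrite mulr_ge0// exprn_ge0.
have K0 : 0 <= 12 * F.+1%:R * th / c0 by rewrite divr_ge0 ?mulr_ge0// ltW.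
have mE b : measurable (E b).
  case: b => [|b] /=; first by apply: countable_measurable => // t; exact: measurable_set1.
  case: ifP => _; first exact: measurable0.
  by apply: bigsetU_measurable => i _; exact: measurable_itv.
have muE b : (mu (E b) <= (e b)%:E)%E.
  case: b => [|b] /=.
    rewrite countable_lebesgue_measure0// lee_fin /e mulr_ge0// invr_ge0 exprn_ge0//.
  case: ltnP => bB; first by rewrite measure0 lee_fin /e mulr_ge0// invr_ge0 exprn_ge0.
  apply: le_trans (@Boole_inequality _ _ _ mu (J b.+1) (K b.+1) _) _.
    by move=> i _; exact: measurable_itv.
  have [/andP[r0 _] rth] := rhoP _ bB.
  apply: (@le_trans _ _ (\sum_(i < K b.+1) (4 * rho b.+1 / c0)%:E)%E).
    apply: lee_sum => i _; rewrite [X in (X <= _)%E](lebesgue_measure_itv `[_, _]) /=.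
    case: ifP => _; last by rewrite lee_fin divr_ge0 ?mulr_ge0// ltW.
    by rewrite -EFinB lee_fin; lra.
  rewrite sumEFin lee_fin sumr_const card_ord -[_ *+ K _]mulr_natl /e.
  apply: (@le_trans _ _ ((3 * (b.+1%:R * F.+1%:R)) * (4 * rho b.+1 / c0))).
    rewrite ler_wpM2r ?divr_ge0 ?mulr_ge0 ?(ltW c00)//.
    by rewrite -!natrM ler_nat /K; lia.
  have b0 : 0 < b.+1%:R :> R by [].
  have -> : 3 * (b.+1%:R * F.+1%:R) * (4 * rho b.+1 / c0) =
     12 * F.+1%:R / c0 * b.+1%:R ^- 2 * (rho b.+1 * b.+1%:R ^+ 3).
    by field; rewrite !gt_eqF.
  have -> : 12 * F.+1%:R * th / c0 / b.+1%:R ^+ 2 = 12 * F.+1%:R / c0 * b.+1%:R ^- 2 * th.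
    by field; rewrite !gt_eqF.
  by rewrite ler_wpM2l// !mulr_ge0 ?invr_ge0 ?exprn_ge0 ?(ltW c00).
have [|z [zuv zE]] := @interval_not_covered E e u v (24 * F.+1%:R * th / c0) mE muE _ thuv.
  move=> n; rewrite /e -mulr_sumr; apply: le_trans (ler_wpM2l K0 (sum_inv_sqr_le n)) _.
  by lra.
exists z; split => //; first exact: (zE 0%N).
move=> b a Bb; rewrite ltNge; apply/negP => fz.
have zuv' : u <= z <= v by case/andP: zuv => /ltW -> /ltW ->.
have b0 : (0 < b)%N by exact: leq_trans Bb.
have bR0 : 0 < b%:R :> R by rewrite ltr0n.
have [/andP[r0 r1] _] := rhoP b Bb.
apply: (zE b); rewrite /E; case: b b0 Bb fz bR0 r0 r1 => // b _ Bb fz bR0 r0 r1.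
rewrite ltnNge Bb /=.
have aF : (`|a| <= (b.+1 * F.+1)%:Z)%R.
  rewrite -(ler_int R) intr_norm -[X in _ <= X]/((b.+1 * F.+1)%:R) natrM mulrC -ler_pdivrMr//.
  have -> : `|a%:~R| / b.+1%:R = `|a%:~R / b.+1%:R| :> R.
    by rewrite normrM normfV (gtr0_norm bR0).
  rewrite -[X in `|X|](subKr (f z)); apply: le_trans (ler_normB _ _) _.
  by rewrite -[F.+1%:R]natr1 lerD ?fF// (le_trans fz).
have [i iK aE] : exists2 i, (i < K b.+1)%N & a = ix b.+1 i.
  exists (absz (a + (b.+1 * F.+1)%:Z)); rewrite /ix /K; move: (b.+1 * F.+1)%N aF => k; clear; lia.
rewrite (bigD1 (Ordinal iK))//=; left; rewrite /J /= -aE in_itv /=.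
have [cuv fcz] : S b.+1 a (c (b.+1, a)).
  by apply: (cP (b.+1, a)); exists z.
have : c0 * `|z - c (b.+1, a)| <= 2 * rho b.+1.
  apply: le_trans (fc _ _ zuv' cuv) _.
  have -> : f z - f (c (b.+1, a)) = (f z - a%:~R / b.+1%:R) - (f (c (b.+1, a)) - a%:~R / b.+1%:R).
    by rewrite opprB addrA subrK.
  apply: le_trans (ler_normB _ _) _; rewrite mulrDl mul1r; exact: lerD.
by rewrite mulrC -ler_pdivlMr// ler_distl.
Qed.

End GenericPoint.

(** * Choosing a good fraction in the window by counting *)

Section GoodNumerator.
Variable R : realType.

Lemma exprVn_le (t : R) m n : 1 <= t -> (n <= m)%N -> t ^- m <= t ^- n.
Proof.
move=> t1 nm; have t0 : 0 < t by exact: lt_le_trans t1.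
by rewrite lef_pV2 ?posrE ?exprn_gt0//; exact: ler_weXn2l.
Qed.

(** Denominators from [T] up to [T^L] fall into [L - 1] scales [T^m <= b <= T^(m+1)]. Each scale
    spoils fewer than [2m] of the [T] candidates, so for [T > 2 L^2] one candidate survives. *)
Lemma good_numerator (U : set R) (f : R -> R) (z : R) L :
  open U -> real_analytic_on U f -> U z ->
  (forall m, (0 < m < L)%N ->
    \det (wronskian_mx (fun j : 'I_(m + m) => afff f m j) z) != 0) ->
  \forall T \near \oo, forall q : int,
    (forall i, (i < T)%N ->
      z <= (q + i%:Z)%:~R / (T ^ 8)%:R <= z + ((T ^ 7)%:R)^-1) ->
    exists2 i, (i < T)%N & forall (b : nat) (a : int), (T <= b < T ^ L)%N ->
      b%:R ^- 30 < `|f ((q + i%:Z)%:~R / (T ^ 8)%:R) - a%:~R / b%:R|.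
Proof.
move=> Uo fU Uz W.
have few : \forall T \near \oo, forall (m : 'I_L), (0 < m)%N ->
    forall (p a : nat -> int) (b : nat -> nat) (x : nat -> R),
    (forall k, x k = (p k)%:~R / (T ^ 8)%:R) ->
    (forall k, (k.+1 < m + m)%N -> p k < p k.+1) ->
    (forall k, (k < m + m)%N -> z <= x k <= z + ((T ^ 7)%:R)^-1) ->
    (forall k, (k < m + m)%N -> (T ^ m <= b k <= T ^ m.+1)%N) ->
    (forall k, (k < m + m)%N -> `|f (x k) - (a k)%:~R / (b k)%:R| <= (b k)%:R ^- 30) ->
    False.
  apply: filter_forall => m; have [m0|m0] := posnP m; first by apply: nearW.
  have := few_near_rational_points Uo fU Uz m0 (W m _); rewrite m0 ltn_ord => /(_ isT).
  by apply: filterS => T H _.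
apply: filterS3 few (nbhs_infty_gt 1) (nbhs_infty_gt (L * (L + L))) => T fewT T1 TL q qT.
pose x i : R := (q + i%:Z)%:~R / (T ^ 8)%:R.
pose bad m i := exists (a : int) (b : nat), (T ^ m <= b <= T ^ m.+1)%N /\
   `|f (x i) - a%:~R / b%:R| <= b%:R ^- 30.
pose bads m := [seq i <- iota 0 T | `[< bad m i >]].
have bads_small m : (0 < m < L)%N -> (size (bads m) < m + m)%N.
  move=> /andP[m0 mL]; rewrite ltnNge; apply/negP => sm.
  have bP k : exists ab : int * nat, (k < m + m)%N ->
      (T ^ m <= ab.2 <= T ^ m.+1)%N /\
      `|f (x (nth 0%N (bads m) k)) - ab.1%:~R / ab.2%:R| <= ab.2%:R ^- 30.
    have [km|mk] := ltnP k (m + m); last by exists (0, 0%N).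
    have : nth 0%N (bads m) k \in bads m by rewrite mem_nth// (leq_trans km).
    by rewrite mem_filter => /andP[/asboolP[a [b ab]] _]; exists (a, b).
  have /choice[ab abP] := bP.
  apply: (fewT (Ordinal mL) m0 (fun k => q + (nth 0%N (bads m) k)%:Z)
    (* The bad indices are a filtered range, hence sorted, so the numerators increase strictly. *)
    (fun k => (ab k).1) (fun k => (ab k).2) (fun k => x (nth 0%N (bads m) k))) => //=.
  - move=> k km; rewrite ltrD2l ltz_nat.
    have : sorted ltn (bads m) by apply: sorted_filter (iota_ltn_sorted 0 T); exact: ltn_trans.
    move=> /(sorted_ltn_nth ltn_trans 0%N); apply => //; rewrite ?inE ?(leq_trans _ sm)//.
    exact: ltnW.
  - move=> k km; apply: qT.
    have : nth 0%N (bads m) k \in bads m by rewrite mem_nth// (leq_trans km).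
    by rewrite mem_filter mem_iota => /andP[_].
  - by move=> k /abP[].
  - by move=> k /abP[].
have [i iT iP] : exists2 i, (i < T)%N & forall m, (0 < m < L)%N -> ~ bad m i.
  apply: contrapT => H.
  have : {subset iota 0 T <= flatten [seq bads m | m <- iota 1 L.-1]}.
    move=> i iT; apply/flatten_mapP; apply: contrapT => Hi; apply: H.
    exists i; first by move: iT; rewrite mem_iota.
    move=> m mL bmi; apply: Hi; exists m; first by rewrite mem_iota; move: mL; clear; lia.
    by rewrite mem_filter iT andbT; apply/asboolP.
  move=> /(uniq_leq_size (iota_uniq _ _)); rewrite size_iota size_flatten leqNgt.
  move=> /negP; apply; apply: leq_ltn_trans TL.
  rewrite sumnE big_map big_map /=.
  apply: (@leq_trans (\sum_(j <- iota 1 L.-1) (L + L))).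
    rewrite big_seq [X in (_ <= X)%N]big_seq; apply: leq_sum => m.
    rewrite mem_iota => mL.
    have mL' : (0 < m < L)%N by move: mL; clear; lia.
    apply: leq_trans (ltnW (bads_small m mL')) _.
    by move: mL'; clear; lia.
  by rewrite big_const_seq count_predT size_iota iter_addn addn0 mulnC leq_mul// leq_pred.
exists i => // b a /andP[Tb bL]; rewrite ltNge; apply/negP => fb.
have b0 : (0 < b)%N by rewrite (leq_trans _ Tb)// ltnW.
pose m := trunc_log T b.
have /andP[Tm Tm1] := trunc_log_bounds T1 b0.
apply: (iP m).
  rewrite trunc_log_gt0 T1 prednK ?(ltnW T1)// Tb /=.
  by have := leq_ltn_trans Tm bL; rewrite ltn_exp2l.
by exists a, b; rewrite Tm (ltnW Tm1).
Qed.

Lemma window_of_ceil (z : R) (T i : nat) : (0 < T)%N -> (i < T)%N ->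
  z <= (Num.ceil (z * (T ^ 8)%:R) + i%:Z)%:~R / (T ^ 8)%:R <= z + ((T ^ 7)%:R)^-1.
Proof.
move=> T0 iT; have T0R : 0 < T%:R :> R by rewrite ltr0n.
have Q0 : 0 < (T ^ 8)%:R :> R by rewrite natrX exprn_gt0.
have := Num.Theory.ceil_itv (z * (T ^ 8)%:R); rewrite intrB => /andP[c1 c2].
rewrite intrD -[i%:Z%:~R]/(i%:R : R).
have i0 : 0 <= i%:R :> R by [].
have i1 : i%:R + 1 <= T%:R :> R by rewrite natr1 ler_nat.
rewrite ler_pdivlMr// ler_pdivrMr// mulrDl.
have -> : (T ^ 7)%:R^-1 * (T ^ 8)%:R = T%:R :> R.
  by rewrite !natrX; field; rewrite gt_eqF.
by apply/andP; split; lra.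
Qed.

End GoodNumerator.

(** * Inductive step *)

Section InductiveStep.
Variable R : realType.

Lemma exprVn_half (b n : nat) : (2 <= b)%N -> (n < 100)%N ->
  (b%:R : R) ^- 100 <= b%:R ^- n / 2.
Proof.
move=> b2 n100; have b1 : 1 <= b%:R :> R by rewrite ler1n ltnW.
have b0 : 0 < b%:R :> R by exact: lt_le_trans b1.
apply: (le_trans (exprVn_le b1 n100)).
rewrite exprSr invfM ler_pM2l ?invr_gt0 ?exprn_gt0//.
by rewrite lef_pV2 ?posrE// (ler_nat _ 2).
Qed.

Variables (U : set R) (f : R -> R) (u0 v0 c0 C : R) (F : nat).
Hypotheses (Uo : open U) (Ui : is_interval U).
Hypotheses (fU : real_analytic_on U f) (fnr : ~ rational_on U f).
Hypothesis subU : forall x, u0 <= x <= v0 -> U x.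
Hypotheses (c00 : 0 < c0) (C1 : 1 <= C).
Hypothesis f_lower : forall x y, u0 <= x <= v0 -> u0 <= y <= v0 ->
  c0 * `|x - y| <= `|f x - f y|.
Hypothesis f_upper : forall x y, u0 <= x <= v0 -> u0 <= y <= v0 ->
  `|f x - f y| <= C * `|x - y|.
Hypothesis f_bound : forall x, u0 <= x <= v0 -> `|f x| <= F%:R.

(** The 48 is the 24 of [generic_point] doubled by the factor 2 in the bound [th] of
    [exists_generic_point]. *)
Definition gap_constant : R := 48 * F.+1%:R / c0.

(* The last clause says that [u, v] is long compared with the total length of
   the sets where [f] is within [2 b^-42] of a rational with denominator [b >= B]. *)
Definition valid_state (s : R * R * nat) : Prop :=
  let: (u, v, B) := s in
  [/\ u0 <= u, u < v, v <= v0, (1 < B)%N & gap_constant * B%:R ^- 39 < v - u].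

(** Exponent 42 makes the loss from [b >= B] of order [B^-39], which the length of the interval
    allows for. From [B1] on, the weaker exponent 4 costs only order [1 / B1], and it leaves margins
    that survive a move of size [T^-7] when [b < T]. *)
Lemma exists_generic_point L u v B : valid_state (u, v, B) ->
  exists z (B1 : nat), [/\ u < z < v, (0 < B1)%N,
    (forall m, (0 < m < L)%N ->
      \det (wronskian_mx (fun j : 'I_(m + m) => afff f m j) z) != 0) &
    forall b (a : int), (B <= b)%N ->
      2 * (if (b < B1)%N then b%:R ^- 42 else b%:R ^- 4) < `|f z - a%:~R / b%:R|].
Proof.
move=> [u0u uv vv0 B1 gapB].
have inV x : u <= x <= v -> u0 <= x <= v0.
  by move=> /andP[ux xv]; rewrite (le_trans u0u ux) (le_trans xv vv0).
have G0 : 0 < gap_constant by rewrite divr_gt0// mulr_gt0.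
have B0 : 0 < B%:R :> R by rewrite ltr0n ltnW.
pose d := v - u - gap_constant * B%:R ^- 39.
have d0 : 0 < d by rewrite subr_gt0.
(* [B2] is chosen so that the loss from denominators at least [B2] fits in the slack [d]. *)
have [B2 [dB2 BB2]] := filter_ex (filterI (near_nat_gt (gap_constant / d)) (nbhs_infty_ge B)).
have B20 : 0 < B2%:R :> R by rewrite (lt_le_trans B0)// ler_nat.
pose th : R := 2 * (B%:R ^- 39 + B2%:R^-1).
pose rho (b : nat) : R := 2 * (if (b < B2)%N then b%:R ^- 42 else b%:R ^- 4).
have rhoP b : (B <= b)%N -> 0 <= rho b <= 1 /\ rho b * b%:R ^+ 3 <= th.
  move=> Bb; have b2 : (2 <= b)%N by exact: leq_trans Bb.
  have b2R : 2 <= b%:R :> R by rewrite (ler_nat _ 2).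
  have b0 : 0 < b%:R :> R by lra.
  have bV : b%:R^-1 <= 2^-1 :> R by rewrite lef_pV2 ?posrE.
  have le1 n : (0 < n)%N -> 0 <= 2 * (b%:R : R) ^- n <= 1.
    move=> n0; rewrite mulr_ge0 ?invr_ge0 ?exprn_ge0 ?(ltW b0)//=.
    have : b%:R ^- n <= b%:R ^- 1 :> R by apply: exprVn_le => //; lra.
    by rewrite expr1; lra.
  rewrite /rho /th; split; first by case: ifP => _; exact: le1.
  rewrite -mulrA ler_pM2l//; case: ltnP => bB2.
    have -> : b%:R ^- 42 * b%:R ^+ 3 = b%:R ^- 39 :> R by field; rewrite gt_eqF.
    rewrite ler_wpDr ?invr_ge0 ?(ltW B20)//.
    rewrite lef_pV2 ?posrE ?exprn_gt0//; apply: lerXn2r; rewrite ?nnegrE ?(ltW B0) ?(ltW b0)//.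
    by rewrite ler_nat.
  have -> : b%:R ^- 4 * b%:R ^+ 3 = b%:R^-1 :> R by field; rewrite gt_eqF.
  rewrite ler_wpDl ?invr_ge0 ?exprn_ge0 ?(ltW B0)//.
  by rewrite lef_pV2 ?posrE// ler_nat.
pose P x := exists m, (0 < m < L)%N /\
  \det (wronskian_mx (fun j : 'I_(m + m) => afff f m j) x) = 0.
have Zfin : finite_set (`[u, v]%classic `&` P).
  apply: finite_isolated => x xuv.
  have : \forall y \near x^', forall m : 'I_L,
      \det (wronskian_mx (fun j : 'I_(m + m) => afff f m j) y) != 0.
    apply: filter_forall => m.
    exact: (afff_wronskian_isolated_zeros m Uo Ui fU fnr (subU (inV _ xuv))).
  apply: filterS => y Wy [m [/andP[_ mL] Wm]].
  by have := Wy (Ordinal mL); rewrite /= Wm eqxx.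
have [||||z [zuv zZ zrho]] := @generic_point _ f u v c0 th F B rho _ uv c00 _ _ _ rhoP
  (finite_set_countable Zfin) _.
- by move=> x y /inV xV /inV yV; exact: f_lower.
- by move=> x /inV; exact: f_bound.
- exact: ltnW.
- have -> : 24 * F.+1%:R * th / c0 = gap_constant * B%:R ^- 39 + gap_constant / B2%:R.
    by rewrite /th /gap_constant; field; rewrite !gt_eqF.
  rewrite -ltrBrDl -/d ltr_pdivrMr// mulrC -ltr_pdivrMr//.
exists z, B2; split => //.
- by rewrite -(ltr0n R).
- move=> m mL; apply/negP => /eqP Wm; apply: zZ; split; last by exists m.
  by rewrite /= in_itv /=; case/andP: zuv => /ltW -> /ltW ->.
Qed.

Lemma inductive_step (M : nat) u v B : valid_state (u, v, B) ->
  exists u' v' B' (p : int) (Q : nat),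
    [/\ valid_state (u', v', B'), [/\ u <= u', v' <= v, (B < B')%N, (2 <= Q)%N & (M < Q)%N] &
    forall x, u' <= x <= v' ->
      0 < `|x - p%:~R / Q%:R| < Q%:R ^- M /\
      forall (b : nat) (a : int), (B <= b < B')%N ->
        b%:R ^- 100 < `|f x - a%:~R / b%:R|].
Proof.
move=> vs; have [u0u uv vv0 B1 gapB] := vs.
(* This ensures [8 M <= 30 L], for the distance to [p / T^8], and [42 <= 30 L], for the margins at
   denominators below [T]. *)
pose L := M.+2.
have [z [B2 [zuv B20 zW zf]]] := exists_generic_point L vs.
have inV x : u <= x <= v -> u0 <= x <= v0.
  by move=> /andP[ux xv]; rewrite (le_trans u0u ux) (le_trans xv vv0).
have /andP[uz zv] := zuv.
have zV : u0 <= z <= v0 by apply: inV; rewrite !ltW.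
have G0 : 0 < gap_constant by rewrite divr_gt0// mulr_gt0.
have C0 : 0 < C by exact: lt_le_trans C1.
have [T [goodT [[MT BT] [[TC TB2] [Tv TK]]]]] :=
  filter_ex (filterI (good_numerator Uo fU (subU zV) zW)
  (filterI (filterI (nbhs_infty_gt M) (nbhs_infty_gt B))
  (filterI (filterI (near_nat_gt C) (near_nat_gt (C * B2%:R ^+ 42)))
  (filterI (near_nat_gt (2 / (v - z))) (near_nat_gt (4 * C * gap_constant)))))).
have Tn1 : (1 < T)%N by exact: ltn_trans BT.
have Tn0 : (0 < T)%N by exact: ltnW.
have [i iT iP] := goodT (Num.ceil (z * (T ^ 8)%:R)) (fun i => @window_of_ceil R z T i Tn0).
have := window_of_ceil z Tn0 iT.
move: iP; set p := _ + i%:Z; set x1 := _ / _ => iP /andP[zx1 x1z].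
pose t : R := T%:R.
have t1 : 1 <= t by rewrite ler1n.
have t0 : 0 < t by exact: lt_le_trans t1.
have tX n : (T ^ n)%:R = t ^+ n :> R by rewrite natrX.
rewrite tX in x1z.
(* Moving by [r] changes [f] by at most half of [T^(-30 L)], a lower bound for [b^-30] when
   [b < T^L]. *)
pose r := (2 * C * t ^+ (30 * L))^-1.
have r0 : 0 < r by rewrite invr_gt0; apply: mulr_gt0; [lra|exact: exprn_gt0].
have rE : r = t ^- (30 * L) / (2 * C).
  by rewrite /r; field; rewrite expf_neq0 ?gt_eqF.
have CrE : C * r = t ^- (30 * L) / 2.
  by rewrite /r; field; rewrite expf_neq0 ?gt_eqF.
have rt : r < t ^- (30 * L).
  rewrite rE ltr_pdivrMr; last by lra.
  have C2 : 1 < 2 * C by have := C1; lra.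
  by rewrite ltr_pMr// invr_gt0 exprn_gt0.
have rle n : (n <= 30 * L)%N -> r < t ^- n.
  by move=> nL; apply: lt_le_trans rt _; exact: exprVn_le.
have t7 : 2 * t ^- 7 <= v - z.
  have t71 : t ^- 7 <= t^-1 by have := @exprVn_le R t 7 1 t1 isT; rewrite expr1.
  apply: (@le_trans _ _ (2 * t^-1)); first by rewrite ler_pM2l.
  rewrite ler_pdivrMr// mulrC -ler_pdivrMr ?subr_gt0//; exact: ltW.
have rt7 : r < t ^- 7 by apply: rle; rewrite /L; clear; lia.
have x1V : u0 <= x1 <= v0.
  have t70 : 0 < t ^- 7 by rewrite invr_gt0 exprn_gt0.
  by apply: inV; apply/andP; split; lra.
have fx1z : `|f x1 - f z| <= C * t ^- 7.
  apply: le_trans (f_upper x1V zV) _; rewrite ler_pM2l// ger0_norm ?subr_ge0//; lra.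
(* Starting at [x1 + r / 2] keeps the new interval away from the fraction [x1] itself. *)
exists (x1 + r / 2), (x1 + r), (T ^ L)%N, p, (T ^ 8)%N; split.
- split.
  + by lra.
  + by lra.
  + by lra.
  + by rewrite (leq_trans Tn1)// -[X in (X <= _)%N]expn1 leq_exp2l.
  (* The new length is of order [T^(-30 L)], far above the required [T^(-39 L)]. *)
  + have -> : x1 + r - (x1 + r / 2) = r / 2 by lra.
    rewrite tX rE -exprM.
    have -> : t ^- (L * 39) = t ^- (30 * L) * t ^- (9 * L).
      by rewrite -invfM -exprD; congr (_ ^- _); rewrite /L; clear; lia.
    have -> : t ^- (30 * L) / (2 * C) / 2 = t ^- (30 * L) * (4 * C)^-1.
      by field; rewrite expf_neq0 ?gt_eqF.
    rewrite mulrCA ltr_pM2l ?invr_gt0 ?exprn_gt0//.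
    rewrite ltr_pdivrMr ?exprn_gt0// mulrC ltr_pdivlMr; last by lra.
    rewrite mulrC.
    apply: lt_le_trans TK _; rewrite -[leLHS]expr1 ler_weXn2l// /L; clear; lia.
- split.
  + by lra.
  + by lra.
  + by rewrite (ltn_trans BT)// -[X in (X < _)%N]expn1 ltn_exp2l.
  + by rewrite (leq_trans Tn1)// -[X in (X <= _)%N]expn1 leq_exp2l.
  + by rewrite (leq_trans MT)// -[X in (X <= _)%N]expn1 leq_exp2l.
move=> x /andP[xl xr].
have xx1 : 0 < x - x1 by lra.
have xV : u0 <= x <= v0 by apply: inV; apply/andP; split; lra.
split.
  rewrite -/x1 gtr0_norm// xx1 /=; apply: (@le_lt_trans _ _ r); first by lra.
  by rewrite tX -exprM; apply: rle; rewrite /L; clear; lia.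
have fxx1 : `|f x - f x1| <= t ^- (30 * L) / 2.
  rewrite -CrE; apply: le_trans (f_upper xV x1V) _; rewrite ler_pM2l// gtr0_norm//; lra.
move=> b a /andP[Bb bL].
have b2 : (2 <= b)%N by exact: leq_trans Bb.
have b0 : 0 < b%:R :> R by rewrite ltr0n ltnW.
have b1 : 1 <= b%:R :> R by rewrite ler1n ltnW.
(* For [b >= T] the choice of the fraction gives exponent 30; for [b < T] the bound at [z] is
   transferred to [x1] and gives exponent 42. *)
have [n [n100 fx1 tb]] : exists n : nat, [/\ (n < 100)%N,
    b%:R ^- n < `|f x1 - a%:~R / b%:R| & t ^- (30 * L) <= b%:R ^- n].
  have [Tb|bT] := leqP T b.
    exists 30%N; split=> //; first by apply: iP; rewrite Tb.
    rewrite lef_pV2 ?posrE ?exprn_gt0// mulnC exprM; apply: lerXn2r.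
    - by rewrite nnegrE ltW.
    - by rewrite nnegrE exprn_ge0// ltW.
    - by rewrite -tX ler_nat ltnW.
  have bt : b%:R <= t by rewrite ler_nat ltnW.
  exists 42%N; split=> //; last first.
    apply: (@le_trans _ _ (t ^- 42)); first by apply: exprVn_le => //; rewrite /L; clear; lia.
    by rewrite lef_pV2 ?posrE ?exprn_gt0//; apply: lerXn2r => //; rewrite nnegrE ltW.
  have := zf b a Bb.
  have zx : `|f z - a%:~R / b%:R| <= `|f x1 - f z| + `|f x1 - a%:~R / b%:R|.
    by rewrite [X in _ <= X + _]distrC; exact: ler_distD.
  (* The transfer costs [C T^-7]. Below [B2] this is at most [b^-42] because [T > C * B2^42]; above,
     it is at most [T^-4 <= b^-4] because [T > C]. *)
  case: ltnP => bB2 zfb.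
    have : C * t ^- 7 <= b%:R ^- 42.
      rewrite -[leRHS]mul1r ler_pdivlMr ?exprn_gt0// mulrAC ler_pdivrMr ?exprn_gt0// mul1r.
      apply: (@le_trans _ _ (C * B2%:R ^+ 42)).
        rewrite ler_pM2l//; apply: lerXn2r; rewrite ?nnegrE ?ler0n// ler_nat; exact: ltnW.
      apply: (le_trans (ltW TB2)); rewrite -[leLHS]expr1; exact: ler_weXn2l.
    by lra.
  have : C * t ^- 7 <= t ^- 4.
    rewrite ler_pdivrMr ?exprn_gt0//.
    have -> : t ^- 4 * t ^+ 7 = t ^+ 3 by field; rewrite gt_eqF.
    apply: (le_trans (ltW TC)); rewrite -[leLHS]expr1; exact: ler_weXn2l.
  have : t ^- 4 <= b%:R ^- 4.
    by rewrite lef_pV2 ?posrE ?exprn_gt0//; apply: lerXn2r => //; rewrite nnegrE ltW.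
  have := @exprVn_le R b%:R 42 4 b1 isT.
  by lra.
(* Half of the margin at [x1] is lost in moving to [x]; since [b >= 2], exponent 100 absorbs the
   factor 2. *)
apply: le_lt_trans (exprVn_half b2 n100) _.
have xx : `|f x1 - a%:~R / b%:R| <= `|f x - f x1| + `|f x - a%:~R / b%:R|.
  by rewrite [X in _ <= X + _]distrC; exact: ler_distD.
by lra.
Qed.

End InductiveStep.

(** * Liouville numbers with badly approximable image *)

Section Assembly.
Variable R : realType.

Lemma finite_pairs_bounded (A : set (int * int)) : finite_set A ->
  exists K : int, forall pq, A pq -> pq.2 <= K.
Proof.
move=> /finite_seqP[s ->]; elim: s => [|pq s [K KP]]; first by exists 0.
exists (Num.max pq.2 K) => pq'; rewrite /= in_cons => /orP[/eqP ->|/KP le].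
  by rewrite le_max lexx.
by rewrite le_max le orbT.
Qed.

(** For an exponent above 100, the hypothesis forces [b < B], and then [a] is bounded as well, so
    only finitely many pairs remain. *)
Lemma irrationality_exponent_le (y : R) (B : nat) :
  (forall (b : nat) (a : int), (B <= b)%N -> b%:R ^- 100 < `|y - a%:~R / b%:R|) ->
  (irrationality_exponent y <= 100%:E)%E.
Proof.
move=> yB; apply: ge_ereal_sup => _ [lam [lam0 inf] <-].
rewrite lee_fin leNgt; apply/negP => lam100; apply: inf.
pose F := Num.bound `|y|.
have yF : `|y| < F%:R by exact: archi_boundP.
pose K := (B * F.+1)%N.
pose A : set (nat * nat) := `I_(2 * K).+1 `*` `I_B.
apply: (@sub_finite_set _ _ ((fun ij : nat * nat => (ij.1%:Z - K%:Z, ij.2%:Z)) @` A)).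
  2: by apply: finite_image; apply: finite_setX; exact: finite_II.
move=> [a b] /= [b0 /andP[_ yab]].
have bE : b = (absz b)%:Z by rewrite gez0_abs// ltW.
move: b0 yab; rewrite bE; move: (absz b) => {bE b} n n0.
rewrite -[(n%:Z)%:~R]/(n%:R : R) => yab.
have n1 : 1 <= n%:R :> R by rewrite ler1n; move: n0; rewrite ltz_nat.
have nR0 : 0 < n%:R :> R by exact: lt_le_trans n1.
have nlam : n%:R `^ (- lam) <= n%:R ^- 100 :> R.
  rewrite powRN lef_pV2 ?posrE ?exprn_gt0 ?powR_gt0// -powR_mulrn ?ler0n//.
  by apply: ler_powR => //; exact: ltW.
have nB : (n < B)%N.
  rewrite ltnNge; apply/negP => Bn; have := lt_le_trans yab nlam.
  by move=> /(lt_trans (yB n a Bn)); rewrite ltxx.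
have aK : (`|a| <= K%:Z)%R.
  apply: (@le_trans _ _ (n * F.+1)%:Z); last by rewrite lez_nat leq_mul2r ltnW ?orbT.
  rewrite -(ler_int R) intr_norm -[X in _ <= X]/((n * F.+1)%:R) natrM mulrC -ler_pdivrMr//.
  have -> : `|a%:~R| / n%:R = `|a%:~R / n%:R| :> R.
    by rewrite normrM normfV (gtr0_norm nR0).
  rewrite -[X in `|X|](subKr y); apply: le_trans (ler_normB _ _) _.
  rewrite -[F.+1%:R]natr1 lerD ?(ltW yF)//; apply: (le_trans (ltW (lt_le_trans yab nlam))).
  by rewrite invf_le1 ?exprn_gt0// exprn_ege1.
exists (absz (a + K%:Z), n).
  split => //=; move: aK; clear; lia.
by congr pair; move: aK => /=; clear; lia.
Qed.

(* The Wronskian of [1, f] is [f'], so [f] is bi-Lipschitz wherever it does not vanish. *)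
Lemma bilipschitz_interval (U V : set R) (f : R -> R) :
  open U -> is_interval U -> real_analytic_on U f -> ~ rational_on U f ->
  open V -> V !=set0 -> V `<=` U ->
  exists (u v c C : R) (F : nat), [/\ u < v, 0 < c & 1 <= C] /\
    [/\ (forall x, u <= x <= v -> V x),
      (forall x y, u <= x <= v -> u <= y <= v -> c * `|x - y| <= `|f x - f y|),
      (forall x y, u <= x <= v -> u <= y <= v -> `|f x - f y| <= C * `|x - y|) &
      (forall x, u <= x <= v -> `|f x| <= F%:R)].
Proof.
move=> Uo Ui fU fnr Vo [x0 Vx0] VU.
have [x1 Vx1 W1] : exists2 x1, V x1 &
    \det (wronskian_mx (fun j : 'I_(1 + 1) => afff f 1 j) x1) != 0.
  have nV : \forall x \near x0^', V x by apply: nbhs_dnbhs; exact: open_nbhs_nbhs.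
  have nW := @afff_wronskian_isolated_zeros R f U 1 x0 Uo Ui fU fnr (VU _ Vx0).
  have nVW : \forall x \near x0^', V x /\
      \det (wronskian_mx (fun j : 'I_(1 + 1) => afff f 1 j) x) != 0.
    exact: filterI nV nW.
  by have [x [Vx Wx]] := @filter_ex _ (x0^') _ _ nVW; exists x.
have df0 : derive1 f x1 != 0.
  (* The second row of the Wronskian matrix of [1, f] is [(0, f')]. *)
  apply: contraNneq W1 => df0; rewrite (expand_det_row _ (lift ord0 ord0)).
  rewrite big1// => j _; rewrite mxE derive1n1.
  have [j0|j0] := ltnP j 1.
    rewrite (_ : afff f 1 j = cst 1); first by rewrite derive1_cst mul0r.
    apply/funext => x; rewrite /afff /aff /aff_expt j0 mulr1.
    by move: j0; rewrite ltnS leqn0 => /eqP ->.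
  rewrite (_ : afff f 1 j = f); first by rewrite df0 mul0r.
  apply/funext => x; rewrite /afff /aff /aff_expt ltnNge j0 /=.
  have -> : nat_of_ord j = 1%N by have := ltn_ord j; move: j0; case: (nat_of_ord j) => [|[|]].
  by rewrite subnn expr0 mul1r.
pose e := `|derive1 f x1|; have e0 : 0 < e by rewrite normr_gt0.
have [d d0 dP] : exists2 d : R, 0 < d & forall x, `|x - x1| < d ->
    V x /\ `|derive1 f x1 - derive1 f x| < e / 2.
  have : \forall x \near x1, V x /\ `|derive1 f x1 - derive1 f x| < e / 2.
    apply: filterI; first exact: open_nbhs_nbhs.
    have cf : derive1 f x @[x --> x1] --> derive1 f x1.
      apply: (@real_analytic_continuous _ U); last exact: VU.
      by rewrite -derive1n1; exact: real_analytic_derive1n.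
    by move/cvgrPdist_lt : cf => /(_ (e / 2)); apply; rewrite divr_gt0.
  move=> /nbhs_ballP[d /= d0 dP]; exists d => // x xd; apply: dP.
  by rewrite /ball/= distrC.
pose u := x1 - d / 2; pose v := x1 + d / 2.
have inV x : u <= x <= v -> V x /\ `|derive1 f x1 - derive1 f x| < e / 2.
  by move=> /andP[ux xv]; apply: dP; rewrite ltr_norml /u /v in ux xv *; apply/andP; split; lra.
have mvt x y : u <= x <= v -> u <= y <= v ->
    exists2 t, u <= t <= v & f x - f y = derive1 f t * (x - y).
  wlog yx : x y / y <= x.
    move=> H xuv yuv; have [yx|/ltW xy] := leP y x; first exact: H.
    have [t tuv tE] := H y x xy yuv xuv; exists t => //.
    by rewrite -opprB tE -mulrN opprB.
  move=> /andP[ux xv] /andP[uy yv].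
  have inUV t : y <= t <= x -> u <= t <= v.
    by move=> /andP[yt tx]; rewrite (le_trans uy yt) (le_trans tx xv).
  have df t : y <= t <= x -> is_derive t 1 f (derive1 f t).
    move=> /inUV /inV[Vt _]; have := @real_analytic_is_derive _ U f 0 t fU (VU _ Vt).
    by rewrite derive1n1.
  have [||t tyx tE] := @MVT_segment R f (derive1 f) y x yx.
  - by move=> t; rewrite in_itv /= => /andP[/ltW yt /ltW tx]; apply: df; rewrite yt.
  - apply: derivable_within_continuous => t; rewrite in_itv /= => /df dft.
    by have [] := dft.
  by exists t => //; apply: inUV; move: tyx; rewrite in_itv.
have lip x y : u <= x <= v -> u <= y <= v -> `|f x - f y| <= (2 * e + 1) * `|x - y|.
  move=> xuv yuv; have [t /inV[_ te] ->] := mvt x y xuv yuv; rewrite normrM.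
  apply: ler_wpM2r => //.
  have := ler_normB (derive1 f x1) (derive1 f x1 - derive1 f t).
  by rewrite subKr -/e; lra.
have x1uv : u <= x1 <= v by rewrite /u /v; apply/andP; split; lra.
pose F := Num.bound (`|f x1| + (2 * e + 1) * d).
(* On this interval [|f'|] lies between [e / 2] and [3 e / 2]; the added 1 secures [1 <= C]. *)
exists u, v, (e / 2), (2 * e + 1), F; split; first by rewrite /u /v; split; lra.
split => //.
- by move=> x /inV[].
- move=> x y xuv yuv; have [t /inV[_ te] ->] := mvt x y xuv yuv; rewrite normrM.
  apply: ler_wpM2r => //.
  have := ler_normD (derive1 f x1 - derive1 f t) (derive1 f t).
  by rewrite subrK -/e; lra.
- move=> x xuv; have FP : `|f x1| + (2 * e + 1) * d < F%:R.
    by apply: archi_boundP; rewrite addr_ge0// mulr_ge0//; lra.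
  apply/ltW; apply: le_lt_trans FP.
  have := ler_normD (f x - f x1) (f x1); rewrite subrK => /le_trans; apply.
  rewrite addrC lerD2l; apply: le_trans (lip _ _ xuv x1uv) _.
  apply: ler_wpM2l; first by lra.
  by move: xuv => /andP[ux xv]; rewrite ler_norml /u /v in ux xv *; apply/andP; split; lra.
Qed.

(** Nested intervals: stage [n] applies [inductive_step] with [M = n]. The common point is within
    [Q^-n] of a fraction at every stage, and the ranges from [B n] to [B n.+1] together cover all
    denominators from [B0] on. *)
Lemma admissible_100 : admissible_exponent (100 : R).
Proof.
move=> U f [Uo Ui] fU fnr V [Vo Vi] Vn0 VU.
have [u0 [v0 [c0 [C [F [[uv0 c00 C1] [subV flo fup fbd]]]]]]] :=
  bilipschitz_interval Uo Ui fU fnr Vo Vn0 VU.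
have subU x : u0 <= x <= v0 -> U x by move=> /subV /VU.
pose valid := valid_state u0 v0 c0 F.
pose next (n : nat) (s s' : R * R * nat) := exists (p : int) (Q : nat),
  [/\ valid s', [/\ s.1.1 <= s'.1.1, s'.1.2 <= s.1.2, (s.2 < s'.2)%N, (2 <= Q)%N & (n < Q)%N] &
    forall x, s'.1.1 <= x <= s'.1.2 ->
      0 < `|x - p%:~R / Q%:R| < Q%:R ^- n /\
      forall (b : nat) (a : int), (s.2 <= b < s'.2)%N ->
        b%:R ^- 100 < `|f x - a%:~R / b%:R|].
have /choice[g gP] : forall ns : nat * (R * R * nat), exists s', valid ns.2 -> next ns.1 ns.2 s'.
  move=> [n [[u v] B]] /=; have [vs|nvs] := pselect (valid (u, v, B)); last first.
    by exists (u, v, B).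
  have [u' [v' [B' [p [Q H]]]]] := inductive_step Uo Ui fU fnr subU c00 C1 flo fup fbd n vs.
  by exists (u', v', B') => _; exists p, Q.
have G0 : 0 < gap_constant c0 F by rewrite divr_gt0// mulr_gt0.
have [B0 [gB0 B02]] := filter_ex (filterI (near_nat_gt (gap_constant c0 F / (v0 - u0)))
  (nbhs_infty_gt 1)).
have vs0 : valid (u0, v0, B0).
  have B01 : 1 <= B0%:R :> R by rewrite ler1n ltnW.
  split => //; apply: (@le_lt_trans _ _ (gap_constant c0 F * B0%:R^-1)).
    by rewrite ler_pM2l//; have := @exprVn_le R B0%:R 39 1 B01 isT; rewrite expr1.
  rewrite ltr_pdivrMr ?(lt_le_trans _ B01)// mulrC -ltr_pdivrMr ?subr_gt0//.
pose s := fix s n := if n is k.+1 then g (k, s k) else (u0, v0, B0).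
have sv n : valid (s n).
  by elim: n => [//|n IH] /=; have [p [Q []]] := gP (n, s n) IH.
have sn n : next n (s n) (s n.+1) by exact: (gP (n, s n) (sv n)).
pose u n := (s n).1.1; pose v n := (s n).1.2; pose B n := (s n).2.
have uS n : u n <= u n.+1 by have [p [Q [_ [? _ _ _ _] _]]] := sn n.
have vS n : v n.+1 <= v n by have [p [Q [_ [_ ? _ _ _] _]]] := sn n.
have BS n : (B n < B n.+1)%N by have [p [Q [_ [_ _ ? _ _] _]]] := sn n.
have uv n : u n < v n by have := sv n; rewrite /u /v; case: (s n) => -[? ?] ? [].
have umono m n : (m <= n)%N -> u m <= u n.
  by move=> mn; have /nondecreasing_seqP := uS; apply.
have vmono m n : (m <= n)%N -> v n <= v m.
  by move=> mn; have /nonincreasing_seqP := vS; apply.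
have ule m n : u m <= v n.
  have [mn|/ltnW nm] := leqP m n; first exact: le_trans (umono _ _ mn) (ltW (uv n)).
  exact: le_trans (ltW (uv m)) (vmono _ _ nm).
pose xi := sup (range u).
have xiP n : u n <= xi <= v n.
  apply/andP; split.
    by apply: ub_le_sup; [exists (v 0%N) => _ [m _ <-]|exists n].
  by apply: ge_sup; [exists (u 0%N), 0%N|move=> _ [m _ <-]].
have fxi (b : nat) (a : int) : (B0 <= b)%N -> b%:R ^- 100 < `|f xi - a%:~R / b%:R|.
  move=> B0b.
  have Bn n : (n <= B n)%N by elim: n => // n IH; exact: leq_ltn_trans IH (BS n).
  have ex : exists n, (b < B n)%N by exists b.+1; exact: Bn.
  case: (ex_minnP ex) => -[|n] bn nmin; first by move: bn; rewrite ltnNge B0b.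
  have Bnb : (B n <= b)%N by rewrite leqNgt; apply/negP => /nmin; rewrite ltnn.
  have [p [Q [_ _ H]]] := sn n; have [_ ] := H xi (xiP n.+1).
  by apply; rewrite -/(B n) -/(B n.+1) Bnb.
exists xi; split.
- by apply: subV; exact: (xiP 0%N).
- move=> N N1 /finite_pairs_bounded[K KP].
  (* At this stage [Q > n] exceeds the supposed bound [K] on denominators, and [Q^-n <= Q^-N]. *)
  pose n := maxn N (absz K).
  have [p [Q [_ [_ _ _ Q2 nQ] H]]] := sn n; have [xQ _] := H xi (xiP n.+1).
  have Q1 : 1 <= Q%:R :> R by rewrite ler1n ltnW.
  have /KP : [set pq : int * int | 2 <= pq.2 /\
      0 < `|xi - pq.1%:~R / pq.2%:~R| < (pq.2%:~R : R) ^- N] (p, Q%:Z).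
    split => //=; rewrite -[(Q%:Z)%:~R]/(Q%:R : R); case/andP: xQ => -> /= /lt_le_trans.
    by apply; apply: exprVn_le => //; rewrite leq_maxl.
  by move=> /=; have := leq_maxr N (absz K); rewrite -/n; move: nQ; clear; lia.
- exact: (irrationality_exponent_le fxi).
- exists B0%:Z => a b B0b.
  have bE : b = (absz b)%:Z by rewrite gez0_abs// (le_trans _ B0b).
  move: B0b; rewrite bE lez_nat => B0b; rewrite -[((absz b)%:Z)%:~R]/((absz b)%:R : R).
  by rewrite powRN powR_mulrn ?ler0n//; exact: fxi.
Qed.

End Assembly.

Theorem theorem1p2 (R : realType) :
  (exists tau : R, 2 < tau /\ admissible_exponent tau) /\
  admissible_exponent (100 : R).
Proof.
split; last exact: admissible_100.
by exists 100; split; [rewrite ltr_nat|exact: admissible_100].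
Qed.
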